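(* Let $G=(VG,EG)$ be a finite undirected graph, $T\subseteq VG$ a set of terminals, $c\colon VG\to\mathbb{Z}_+$ node capacities, $a\colon VG\to\mathbb{Z}_+$ node costs, and $\lambda\in\mathbb{Z}_+$. Then the problem of finding a feasible multiflow $F$ maximizing $\Phi(F,a,\lambda)=\lambda\cdot\operatorname{val}(F)-a(F)$ has an optimal solution $F$ that is half-integer, i.e. $F(P)\in\frac12\mathbb{Z}_+$ for every $T$-path $P$.
   Context: A path is an edge-simple walk; $VP$ denotes its set of nodes. Nodes of $VG-T$ are called inner. A $T$-path is a path whose two ends are distinct terminals and whose other nodes are inner; $\mathcal{P}$ denotes the set of $T$-paths. A multiflow is a function $F\colon\mathcal{P}\to\mathbb{Q}_+$. Its value is $\operatorname{val}(F)=\sum_{P}F(P)$, its node load is $\hat F(v)=\sum(F(P): P\in\mathcal{P},\ v\in VP)$, and it is feasible if $\hat F(v)\le c(v)$ for all $v\in VG$. Its cost is $a(F)=\sum_P a(VP)F(P)$, where $a(VP)=\sum_{v\in VP}a(v)$. *)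

(* Defs.v *)
From HB Require Import structures.
From mathcomp Require Import all_boot all_order all_algebra.
Set Implicit Arguments.
Unset Strict Implicit.
Unset Printing Implicit Defensive.
Import Order.TTheory GRing.Theory Num.Theory.
Local Open Scope ring_scope.

(* Parallel edges and loops are allowed: edges are abstract objects carrying a
   set of one (loop) or two end nodes. *)
Record graph := Graph {
  node : finType;
  edge : finType;
  ends : edge -> {set node};
  ends_card : forall e, (0 < #|ends e| <= 2)%N
}.

(* The walk v0, e1, v1, ..., ek, vk is encoded as
   (v0, [:: (e1, v1); ...; (ek, vk)]). Nodes may repeat, and a walk is not
   identified with its reverse. *)
Fixpoint is_walk (G : graph) (v : node G) (s : seq (edge G * node G)) : bool :=
  if s is (e, w) :: s' then (ends e == [set v; w]) && is_walk w s' else true.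

Definition is_path (G : graph) (v : node G) (s : seq (edge G * node G)) : bool :=
  is_walk v s && uniq (unzip1 s).

(* Every occurrence of a node other than the first and the last is inner. *)
Definition is_Tpath (G : graph) (T : {set node G})
    (v : node G) (s : seq (edge G * node G)) : bool :=
  let w := last v (unzip2 s) in
  [&& is_path v s, v \in T, w \in T, v != w
    & all (fun u => u \notin T) (behead (belast v (unzip2 s)))].

Lemma is_path_size (G : graph) (v : node G) (s : seq (edge G * node G)) :
  is_path v s -> (size s <= #|edge G|)%N.
Proof. by case/andP=> _ /card_uniqP; rewrite size_map => <-; exact: max_card. Qed.

(* By is_path_size, bounding the length by the number of edges loses no path;
   it makes the set of T-paths a finType. *)
Definition Tpath (G : graph) (T : {set node G}) : finType :=
  {P : node G * #|edge G|.-bseq (edge G * node G) | is_Tpath T P.1 P.2}.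

Definition VP (G : graph) (T : {set node G}) (P : Tpath T) : {set node G} :=
  [set v in (val P).1 :: unzip2 (val P).2].

Section Multiflow.
Variables (G : graph) (T : {set node G}).
Implicit Types (F : Tpath T -> rat) (a c : node G -> nat).

Definition multiflow F : Prop := forall P, 0 <= F P.

Definition value F : rat := \sum_P F P.

Definition load F (v : node G) : rat := \sum_(P : Tpath T | v \in VP P) F P.

Definition feasible c F : Prop :=
  multiflow F /\ forall v, load F v <= (c v)%:R.

Definition cost a F : rat := \sum_P (\sum_(v in VP P) a v)%:R * F P.

Definition Phi a (lambda : nat) F : rat := lambda%:R * value F - cost a F.

Definition optimal c a (lambda : nat) F : Prop :=
  feasible c F /\ forall F', feasible c F' -> Phi a lambda F' <= Phi a lambda F.

Definition half_integer F : Prop := forall P, exists k : nat, F P = k%:R / 2%:R.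

End Multiflow.

(* Main.v *)
Require Import Defs.
From mathcomp Require Import all_boot all_order all_algebra.
From mathcomp Require Import ring lra zify.
From Stdlib Require Import Classical_Prop.
Set Implicit Arguments.
Unset Strict Implicit.
Unset Printing Implicit Defensive.
Import Order.TTheory GRing.Theory Num.Theory.
Local Open Scope ring_scope.

(* A small perturbation makes the costs positive, and half-integrality of [Phi]
   absorbs it. Let [l] be an optimal dual solution and [w = a + l]. Paths of an
   optimal fractional multiflow have [w]-length exactly [lambda], the least
   possible, so a node lies at a fixed distance from one terminal, its home, or
   exactly in the middle of every such path (a central node). Conversely, an edge
   flow on the shortest-path edges decomposes into such paths as soon as flow up
   equals flow down at noncentral nodes, while at central nodes no terminal
   accounts for more than half of the flow. Rounding the bipartite double cover
   gives a half-integral edge flow which may violate only the last condition; the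
   first violation on the segment from the fractional to the rounded flow is an
   equality at some central node, which is then declared balanced between that
   terminal and the others, and one rounds again. *)

(** * Linear programming duality *)

(** Positive weights [w] serve three ends: shortest walks between terminals are simple, they have no
    terminal in their interior, and distances strictly drop towards a home, so that following the
    flow downwards terminates. The obstacle is the central nodes. At other inner nodes the edges
    have two fixed sides, and equality of the sides survives rounding; at a central node walks may
    join any two distinct homes, and an integer flow can be paired off in this way exactly when its
    total is even and no home carries more than half. Bipartite rounding cannot enforce these
    inequalities. The factor two arises because the two copies of an edge in the double cover may be
    rounded differently and are then added; this also makes degrees at inner nodes even. Flows live
    on pairs of nodes, so parallel edges are merged until walks are lifted back to the graph. *)

Section Farkas.
Variable I : finType.
Local Notation constraint := ({ffun I -> rat} * rat)%type.
Implicit Types (x : I -> rat) (k : constraint) (S : seq constraint).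

Definition sat x k := \sum_i k.1 i * x i <= k.2.

(** An inductive closure under nonnegative combinations keeps multipliers out of the elimination;
    they are recovered by induction where a certificate is used. *)
Inductive derivable S : {ffun I -> rat} -> rat -> Prop :=
| Der_in k : k \in S -> derivable S k.1 k.2
| Der_add g1 g2 b1 b2 : derivable S g1 b1 -> derivable S g2 b2 ->
    derivable S [ffun i => g1 i + g2 i] (b1 + b2)
| Der_scale m g b : 0 <= m -> derivable S g b ->
    derivable S [ffun i => m * g i] (m * b).

Lemma derivable_trans S1 S2 g b :
  (forall k, k \in S1 -> derivable S2 k.1 k.2) ->
  derivable S1 g b -> derivable S2 g b.
Proof.
move=> S12; elim=> [k /S12 // | g1 g2 b1 b2 _ + _ + | m g1 b1 m0 _].
- exact: Der_add.
- exact: Der_scale.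
Qed.

Definition elim_pair (j : I) k1 k2 : constraint :=
  ([ffun i => - k2.1 j * k1.1 i + k1.1 j * k2.1 i], - k2.1 j * k1.2 + k1.1 j * k2.2).

Definition fourier_motzkin (j : I) S :=
  [seq k : constraint <- S | k.1 j == 0] ++
  [seq elim_pair j k1 k2 | k1 <- [seq k : constraint <- S | 0 < k.1 j], k2 <- [seq k : constraint <- S | k.1 j < 0]].

Lemma fourier_motzkin_derivable j S k :
  k \in fourier_motzkin j S -> derivable S k.1 k.2.
Proof.
rewrite mem_cat mem_filter => /orP[/andP[_ kS]|]; first exact: Der_in.
case/allpairsP=> -[k1 k2] /= []; rewrite !mem_filter => /andP[k1p k1S] /andP[k2n k2S] ->.
have k2n' : 0 <= - k2.1 j by rewrite oppr_ge0 ltW.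
have := Der_add (Der_scale k2n' (Der_in k1S)) (Der_scale (ltW k1p) (Der_in k2S)).
congr derivable.
by apply/ffunP=> i; rewrite !ffunE.
Qed.

Lemma separate (A B : seq rat) :
  (forall a b, a \in A -> b \in B -> a <= b) ->
  exists z, (forall a, a \in A -> a <= z) /\ (forall b, b \in B -> z <= b).
Proof.
elim: A => [|a A IH] AB.
  elim: B {AB} => [|b B [z [_ zB]]]; first by exists 0.
  exists (Num.min b z); split=> // b'; rewrite inE ge_min => /orP[/eqP->|/zB->].
    by rewrite lexx.
  by rewrite orbT.
have [|z [zA zB]] := IH; first by move=> a' b a'A; apply: AB; rewrite inE a'A orbT.
exists (Num.max a z); split=> [a'|b bB].
  by rewrite inE le_max => /orP[/eqP->|/zA->]; rewrite ?lexx ?orbT.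
by rewrite ge_max zB // AB ?mem_head.
Qed.

(** With the other coordinates of [x] kept, each constraint involving [j] bounds that coordinate
    from one side. The eliminated system says that every lower bound is below every upper bound, so
    [separate] supplies a value. *)
Lemma fourier_motzkin_sat j S x :
  (forall k, k \in fourier_motzkin j S -> sat x k) ->
  exists y, forall k, k \in S -> sat y k.
Proof.
move=> satx.
pose r k := \sum_(i | i != j) k.1 i * x i.
pose bd k := (k.2 - r k) / k.1 j.
have [a b|z [zlo zhi]] := @separate [seq bd k | k : constraint <- S & k.1 j < 0] [seq bd k | k : constraint <- S & 0 < k.1 j].
  case/mapP=> k2; rewrite mem_filter => /andP[k2n k2S] ->.
  case/mapP=> k1; rewrite mem_filter => /andP[k1p k1S] ->.
  have /satx : elim_pair j k1 k2 \in fourier_motzkin j S.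
    rewrite mem_cat; apply/orP; right; apply/allpairsP; exists (k1, k2).
    by rewrite !mem_filter k1p k2n.
  rewrite /sat /= (eq_bigr (fun i => - k2.1 j * (k1.1 i * x i) + k1.1 j * (k2.1 i * x i)));
    last first.
    by move=> i _; rewrite ffunE; ring.
  rewrite big_split /= -!mulr_sumr (bigD1 j) //= [X in _ + _ * X](bigD1 j) //= -/(r k1) -/(r k2) => H.
  rewrite /bd ler_ndivrMr // mulrAC ler_pdivrMr //; nra.
exists (fun i => if i == j then z else x i) => k kS.
have rE : \sum_i k.1 i * (if i == j then z else x i) = k.1 j * z + r k.
  rewrite (bigD1 j) //= eqxx; congr (_ + _).
  by apply: eq_bigr => i /negbTE ->.
rewrite /sat rE; case: (ltgtP (k.1 j) 0) => kj.
- have /zlo : bd k \in [seq bd k | k : constraint <- S & k.1 j < 0] by rewrite map_f ?mem_filter ?kj.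
  by rewrite /bd ler_ndivrMr // => H; lra.
- have /zhi : bd k \in [seq bd k | k : constraint <- S & 0 < k.1 j] by rewrite map_f ?mem_filter ?kj.
  by rewrite /bd ler_pdivlMr // => H; lra.
- have /satx : k \in fourier_motzkin j S by rewrite mem_cat mem_filter kj eqxx kS.
  by rewrite /sat (bigD1 j) //= -/(r k) kj; lra.
Qed.

Lemma farkas S :
  (exists x, forall k, k \in S -> sat x k) \/ (exists2 b, b < 0 & derivable S [ffun=> 0] b).
Proof.
(* The induction runs over the coordinates not yet eliminated; once none is left, each constraint
   reads [0 <= b]. *)
have : forall k, k \in S -> forall i, i \notin enum I -> k.1 i = 0.
  by move=> k _ i; rewrite mem_enum.
elim: (enum I) S => [|j s IH] S S0.
  have [/hasP[k kS k0]|/hasPn Sge] := boolP (has (fun k => k.2 < 0) S).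
    right; exists k.2 => //; have -> : [ffun=> 0] = k.1; last exact: Der_in.
    by apply/ffunP=> i; rewrite ffunE S0.
  left; exists (fun=> 0) => k /Sge; rewrite -leNgt /sat big1 // => i _.
  by rewrite mulr0.
have [|[x satx]|[b b0 derb]] := IH (fourier_motzkin j S).
- move=> k; rewrite mem_cat mem_filter => /orP[/andP[/eqP kj kS] i|].
    by have [->//|ij ins] := eqVneq i j; apply: S0 => //; rewrite inE negb_or ij.
  case/allpairsP=> -[k1 k2] /= []; rewrite !mem_filter => /andP[k1p k1S] /andP[k2n k2S] -> i ins.
  rewrite /= ffunE; have [->|ij] := eqVneq i j; first by ring.
  have ijs : i \notin j :: s by rewrite inE negb_or ij.
  by rewrite (S0 _ k1S _ ijs) (S0 _ k2S _ ijs) !mulr0 addr0.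
- by left; apply: fourier_motzkin_sat satx.
- by right; exists b => //; apply: derivable_trans derb => k; apply: fourier_motzkin_derivable.
Qed.

End Farkas.

(** * Strong duality for fractional packing *)

Section Duality.
Variables (P V : finType) (A : P -> {set V}) (c : V -> rat) (r : P -> rat).
Hypotheses (c_ge0 : forall v, 0 <= c v) (A_neq0 : forall p, A p != set0).

Lemma sum_incidence (F : P -> rat) (l : V -> rat) :
  \sum_p (\sum_(v in A p) l v) * F p = \sum_v l v * \sum_(p | v \in A p) F p.
Proof.
under eq_bigr => p _ do rewrite mulr_suml.
under [RHS]eq_bigr => v _ do rewrite mulr_sumr.
rewrite (exchange_big_dep predT) //=.
Qed.

(** The system asks at once for a packing, a cover and the reverse of weak duality; Farkas turns its
    infeasibility into multipliers that contradict weak duality. *)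
Theorem packing_duality : exists (F : P -> rat) (l : V -> rat),
  [/\ forall p, 0 <= F p,
      forall v, \sum_(p | v \in A p) F p <= c v,
      forall v, 0 <= l v,
      forall p, r p <= \sum_(v in A p) l v &
      \sum_v c v * l v <= \sum_p r p * F p].
Proof.
pose J := (P + V)%type.
pose vec (f : P -> rat) (g : V -> rat) : {ffun J -> rat} :=
  [ffun j => match j with inl p => f p | inr v => g v end].
pose kF p := (vec (fun q => - (q == p)%:R) (fun=> 0), 0 : rat).
pose kl v := (vec (fun=> 0) (fun u => - (u == v)%:R), 0 : rat).
pose kc v := (vec (fun p => (v \in A p)%:R) (fun=> 0), c v).
pose kr p := (vec (fun=> 0) (fun v => - (v \in A p)%:R), - r p).
pose ko := (vec (fun p => - r p) c, 0 : rat).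
pose S := ko :: (map kF (enum P) ++ map kl (enum V) ++ map kc (enum V) ++ map kr (enum P)).
have sumJ f g x : \sum_j vec f g j * x j =
    \sum_p f p * x (inl p) + \sum_v g v * x (inr v).
  by rewrite big_sumType /=; congr (_ + _); apply: eq_bigr => i _; rewrite ffunE.
have [[x satx]|[b b0 derb]] := farkas S.
  have inF p : kF p \in S by rewrite !(inE, mem_cat) map_f ?mem_enum ?orbT.
  have inl' v : kl v \in S by rewrite !(inE, mem_cat) (map_f kl) ?mem_enum ?orbT.
  have inc v : kc v \in S by rewrite !(inE, mem_cat) (map_f kc) ?mem_enum ?orbT.
  have inr' p : kr p \in S by rewrite !(inE, mem_cat) (map_f kr) ?mem_enum ?orbT.
  exists (fun p => x (inl p)), (fun v => x (inr v)); split.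
  - move=> p; have := satx _ (inF p); rewrite /sat sumJ [X in _ + X]big1 ?addr0;
    last by move=> v; rewrite mul0r.
    rewrite (bigD1 p) //= eqxx big1 ?addr0; last by move=> q /negbTE ->; rewrite oppr0 mul0r.
    by rewrite mulN1r oppr_le0.
  - move=> v; have := satx _ (inc v); rewrite /sat sumJ [X in _ + X]big1 ?addr0;
    last by move=> u; rewrite mul0r.
    rewrite [X in _ -> X <= _]big_mkcond /=; congr (_ <= _).
    by apply: eq_bigr => p _; case: (v \in A p); rewrite ?mul1r ?mul0r.
  - move=> v; have := satx _ (inl' v); rewrite /sat sumJ [X in X + _]big1 ?add0r;
    last by move=> p; rewrite mul0r.
    rewrite (bigD1 v) //= eqxx big1 ?addr0; last by move=> u /negbTE ->; rewrite oppr0 mul0r.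
    by rewrite mulN1r oppr_le0.
  - move=> p; have := satx _ (inr' p); rewrite /sat sumJ [X in X + _]big1 ?add0r;
    last by move=> q; rewrite mul0r.
    rewrite -lerN2 opprK -sumrN [X in _ -> _ <= X]big_mkcond /=; congr (_ <= _).
    by apply: eq_bigr => v _; case: (v \in A p); rewrite ?mulN1r ?opprK ?oppr0 ?mul0r ?oppr0.
  - have := satx _ (mem_head _ _); rewrite /sat sumJ /=.
    rewrite (eq_bigr (fun p => - (r p * x (inl p)))); last by move=> p _; rewrite mulNr.
    rewrite sumrN; lra.
exfalso.
(* [y], [z] and [m] are the multipliers of the packing rows, the covering rows and the objective
   row; those of the sign constraints are dropped, which turns equations into inequalities. *)
have [y [z [m [y0 z0 m0 [yP zV bE]]]]] : exists (y : V -> rat) (z : P -> rat) (m : rat),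
  [/\ forall v, 0 <= y v, forall p, 0 <= z p, 0 <= m &
   [/\ forall p, 0 <= \sum_(v in A p) y v - m * r p,
      forall v, 0 <= m * c v - \sum_(p | v \in A p) z p &
      \sum_v c v * y v - \sum_p r p * z p <= b]].
  pose inv (k : {ffun J -> rat}) b := exists (y : V -> rat) (z : P -> rat) (m : rat),
    [/\ forall v, 0 <= y v, forall p, 0 <= z p, 0 <= m &
     [/\ forall p, k (inl p) <= \sum_(v in A p) y v - m * r p,
      forall v, k (inr v) <= m * c v - \sum_(p | v \in A p) z p &
      \sum_v c v * y v - \sum_p r p * z p <= b]].
  suff /(_ _ _ derb) [y [z [m [y0 z0 m0 [H1 H2 H3]]]]] : forall k b, derivable S k b -> inv k b.
    exists y, z, m; split=> //; split=> // [p|v]; first by have := H1 p; rewrite ffunE.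
    by have := H2 v; rewrite ffunE.
  have s0 (I : finType) (Q : pred I) : \sum_(i | Q i) (0 : rat) = 0 by rewrite big1.
  have s00 (I : finType) (Q : pred I) f : \sum_(i | Q i) f i * (0 : rat) = 0.
    by rewrite big1 // => i _; rewrite mulr0.
  move=> {b b0 derb} k b; elim=> {k b}.
  - move=> k; rewrite inE !mem_cat => /orP[/eqP ->|].
      exists (fun=> 0), (fun=> 0), 1; split=> //; split=> [p|v|] /=; rewrite ?ffunE ?s0 ?s00; lra.
    case/or4P=> /mapP[i _ ->].
    + exists (fun=> 0), (fun=> 0), 0; split=> //; split=> [p|v|] /=;
      rewrite ?ffunE ?s0 ?s00 ?mul0r ?subr0 ?oppr_le0 ?ler0n //.
    + exists (fun=> 0), (fun=> 0), 0; split=> //; split=> [p|v|] /=;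
      rewrite ?ffunE ?s0 ?s00 ?mul0r ?subr0 ?oppr_le0 ?ler0n //.
    + exists (fun v => (v == i)%:R), (fun=> 0), 0; split=> //; split=> [p|v|] /=;
      rewrite ?ffunE ?s0 ?s00 ?mul0r ?subr0 ?ler0n //.
        case: (boolP (i \in A p)) => iA; last by rewrite sumr_ge0.
        by rewrite (bigD1 i) //= eqxx lerDl sumr_ge0.
      by rewrite (bigD1 i) //= eqxx mulr1 big1 ?addr0 // => v /negbTE ->; rewrite mulr0.
    + exists (fun=> 0), (fun p => (p == i)%:R), 0; split=> //; split=> [p|v|] /=;
      rewrite ?ffunE ?s0 ?s00 ?mul0r ?subr0 ?sub0r ?ler0n //.
        rewrite lerN2; case: (boolP (v \in A i)) => iA; last first.
          by rewrite big1 // => p; have [->|//] := eqVneq p i; rewrite (negbTE iA).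
        by rewrite (bigD1 i) //= eqxx big1 ?addr0 // => p /andP[_ /negbTE ->].
      by rewrite lerN2 (bigD1 i) //= eqxx mulr1 lerDl big1 // => v /negbTE ->; rewrite mulr0.
  - move=> k1 k2 b1 b2 _ [y1 [z1 [m1 [y10 z10 m10 [H1 H2 H3]]]]] _ [y2 [z2 [m2 [y20 z20 m20 [G1 G2 G3]]]]].
    exists (fun v => y1 v + y2 v), (fun p => z1 p + z2 p), (m1 + m2); split=> [v|p||].
    + by rewrite addr_ge0.
    + by rewrite addr_ge0.
    + by rewrite addr_ge0.
    split=> [p|v|].
    + by rewrite ffunE big_split /=; have := H1 p; have := G1 p; lra.
    + by rewrite ffunE big_split /=; have := H2 v; have := G2 v; lra.
    + rewrite (eq_bigr (fun v => c v * y1 v + c v * y2 v)); last by move=> v _; rewrite mulrDr.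
      rewrite [X in _ - X](eq_bigr (fun p => r p * z1 p + r p * z2 p)); last by move=> v _;
        rewrite mulrDr.
      rewrite !big_split /=; lra.
  - move=> m k b m0 _ [y1 [z1 [m1 [y10 z10 m10 [H1 H2 H3]]]]].
    exists (fun v => m * y1 v), (fun p => m * z1 p), (m * m1); split=> [v|p||].
    + by rewrite mulr_ge0.
    + by rewrite mulr_ge0.
    + by rewrite mulr_ge0.
    split=> [p|v|].
    + by rewrite ffunE -mulr_sumr; have := ler_wpM2l m0 (H1 p); lra.
    + by rewrite ffunE -mulr_sumr; have := ler_wpM2l m0 (H2 v); lra.
    + rewrite (eq_bigr (fun v => m * (c v * y1 v))); last by move=> v _; ring.
      rewrite [X in _ - X](eq_bigr (fun p => m * (r p * z1 p))); last by move=> v _; ring.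
      by rewrite -!mulr_sumr; have := ler_wpM2l m0 H3; lra.
have yc0 : 0 <= \sum_v c v * y v by rewrite sumr_ge0 // => v _; rewrite mulr_ge0.
(* With [m = 0], nonempty sets force [z = 0], and the nonnegative cost of [y] would be at most
   [b < 0]; with [m > 0], [y / m] and [z / m] are a cover and a packing. *)
have [m_eq0|m_neq0] := eqVneq m 0.
  have z_eq0 p : z p = 0.
    have /set0Pn[v vA] := A_neq0 p.
    have := zV v; rewrite m_eq0 mul0r sub0r (bigD1 p) //= => H.
    have : 0 <= \sum_(q | (v \in A q) && (q != p)) z q by rewrite sumr_ge0.
    have := z0 p; lra.
  move: bE; rewrite [X in _ - X]big1; last by move=> p _; rewrite z_eq0 mulr0.
  lra.
have {m0 m_neq0} m0 : 0 < m by rewrite lt_def m_neq0.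
have : m * \sum_p r p * z p <= m * \sum_v c v * y v.
  rewrite !mulr_sumr; apply: (@le_trans _ _ (\sum_p (\sum_(v in A p) y v) * z p)).
    apply: ler_sum => p _; rewrite mulrA ler_wpM2r //; have := yP p; lra.
  rewrite sum_incidence; apply: ler_sum => v _.
  by rewrite mulrA mulrC ler_wpM2r //; have := zV v; lra.
rewrite ler_pM2l //; lra.
Qed.

End Duality.

(** * Rounding *)

Section Rounding.
Variables (D X Y : finType) (tl : D -> X) (hd : D -> Y).

(** A single non-integral entry in a fiber would make the sum over the fiber non-integral. *)
Lemma fiber_card_ge2 (Z : finType) (z : D -> Z) (g : D -> rat) (N : {set D}) :
  N = [set d | g d \isn't a Num.int] ->
  (forall x, \sum_(d | z d == x) g d \is a Num.int) ->
  (2 * #|z @: N| <= #|N|)%N.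
Proof.
move=> NE margin.
have -> : #|N| = (\sum_(x in z @: N) #|[set d in N | z d == x]|)%N.
  rewrite -sum1_card (partition_big_imset z) /=; apply: eq_bigr => x _.
  by rewrite -sum1_card; apply: eq_bigl => d; rewrite inE.
rewrite mulnC -sum_nat_const; apply: leq_sum => _ /imsetP[d dN ->].
rewrite ltnNge; apply/negP => le1.
have only d' : d' \in N -> z d' == z d -> d' = d.
  move=> d'N zd'; apply/eqP; move: le1; apply: contraLR => dd'; rewrite -ltnNge.
  have <- : #|[set d'; d]| = 2%N by rewrite cards2 dd'.
  rewrite subset_leq_card //; apply/subsetP => e.
  by rewrite !inE => /orP[]/eqP ->; rewrite ?d'N ?dN ?zd' ?eqxx.
have := margin (z d); rewrite (bigD1 d) //= rpredDr; last first.
  apply: rpred_sum => e /andP[ze ed]; apply: contraR ed => eN.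
  by rewrite (only e) // NE inE.
by move: dN; rewrite NE inE => /negP.
Qed.

(** In the incidence matrix the tail columns and the head columns have the same sum, so the rank is
    below the number of columns, which is at most [#|N|]: the left kernel is nonzero. *)
Lemma circulation (N : {set D}) :
  N != set0 -> (2 * #|tl @: N| <= #|N|)%N -> (2 * #|hd @: N| <= #|N|)%N ->
  exists p : D -> rat, [/\ exists d, p d != 0, forall d, d \notin N -> p d = 0,
    forall x, \sum_(d | tl d == x) p d = 0 & forall y, \sum_(d | hd d == y) p d = 0].
Proof.
move=> N0 tl2 hd2.
pose tN := tl @: N; pose hN := hd @: N.
pose inc (Z : finType) (z : D -> Z) (B : {set Z}) :=
  \matrix_(i < #|N|, j < #|B|) ((z (enum_val i) == enum_val j)%:R : rat).
pose M := row_mx (inc _ tl tN) (inc _ hd hN).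
have inc1 (Z : finType) (z : D -> Z) (B : {set Z}) : B = z @: N ->
    inc _ z B *m const_mx 1 = (const_mx 1 : 'cV_ _).
  move=> BE; apply/matrixP => i j; rewrite !mxE.
  have zi : z (enum_val i) \in B by rewrite BE imset_f ?enum_valP.
  rewrite (bigD1 (enum_rank_in zi (z (enum_val i)))) //= !mxE enum_rankK_in // eqxx mulr1.
  rewrite big1 ?addr0 // => k; rewrite !mxE mulr1 => kz; case: eqP => // zk.
  by case/eqP: kz; apply: enum_val_inj; rewrite enum_rankK_in.
have Mv : M *m col_mx (const_mx 1) (- const_mx 1 : 'cV_ _) = 0.
  by rewrite mul_row_col mulmxN !inc1 // subrr.
have vN0 : col_mx (const_mx 1) (- const_mx 1 : 'cV_#|hN|) != 0 :> 'cV[rat]_(#|tN| + #|hN|).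
  rewrite col_mx_eq0 negb_and; apply/orP; left.
  have /set0Pn[d dN] := N0; have td : tl d \in tN by rewrite imset_f.
  apply/eqP => /matrixP /(_ (enum_rank_in td (tl d)) 0) /eqP.
  by rewrite !mxE oner_eq0.
have rkM : (\rank M < #|N|)%N.
  have := mulmx0_rank_max Mv; move: vN0; rewrite -mxrank_eq0 -lt0n.
  move: (\rank _) (\rank M) tl2 hd2 => a b; rewrite -/tN -/hN; lia.
have /rowV0Pn[u /sub_kermxP uM u0] : kermx M != 0.
  by rewrite kermx_eq0 /row_free neq_ltn rkM.
pose p d := \sum_i (enum_val i == d)%:R * u 0 i.
have pE i : p (enum_val i) = u 0 i.
  rewrite /p (bigD1 i) //= eqxx mul1r big1 ?addr0 // => j ji.
  by rewrite (inj_eq enum_val_inj) (negbTE ji) mul0r.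
have margin (Z : finType) (z : D -> Z) (B : {set Z}) : B = z @: N ->
    u *m inc _ z B = 0 -> forall x, \sum_(d | z d == x) p d = 0.
  move=> BE uB x; rewrite exchange_big /=.
  have -> : \sum_i \sum_(d | z d == x) (enum_val i == d)%:R * u 0 i =
      \sum_i (z (enum_val i) == x)%:R * u 0 i.
    apply: eq_bigr => i _; rewrite -mulr_suml; congr (_ * _).
    have [zx|zx] := boolP (z (enum_val i) == x).
      rewrite (bigD1 (enum_val i)) //= eqxx big1 ?addr0 // => d /andP[_ dn].
      by rewrite eq_sym (negbTE dn).
    by rewrite big1 // => d zd; case: eqP => // di; rewrite di zd in zx.
  have [xB|xB] := boolP (x \in B).
    have /matrixP/(_ 0 (enum_rank_in xB x)) := uB; rewrite !mxE => uBx; rewrite -[RHS]uBx.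
    by apply: eq_bigr => i _; rewrite mxE enum_rankK_in // mulrC.
  rewrite big1 // => i _; case: eqP => [zx|]; last by rewrite mul0r.
  by case/negP: xB; rewrite -zx BE imset_f ?enum_valP.
move: uM; rewrite mul_mx_row => /eqP; rewrite row_mx_eq0 => /andP[/eqP uT /eqP uH].
exists p; split=> [|d dN||].
- have /rV0Pn[i ui] := u0; by exists (enum_val i); rewrite pE.
- rewrite /p big1 // => i _; case: eqP => [ed|]; last by rewrite mul0r.
  by case/negP: dN; rewrite -ed enum_valP.
- exact: margin uT.
- exact: margin uH.
Qed.

Lemma rounding_step (g p : D -> rat) :
  (exists d, p d != 0) ->
  (forall d, p d != 0 -> g d \isn't a Num.int) ->
  exists e, [/\ 0 < e, forall d, (Num.floor (g d))%:~R <= g d + e * p d <= (Num.ceil (g d))%:~R &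
    exists2 d, p d != 0 & g d + e * p d \is a Num.int].
Proof.
case=> d0 pd0 gN.
(* The largest step along [p] that keeps entry [d] between its floor and its ceiling; the minimum
   over the support of [p] makes one entry integral. *)
pose room d := if 0 < p d then ((Num.ceil (g d))%:~R - g d) / p d
               else ((Num.floor (g d))%:~R - g d) / p d.
have [d1 pd1 min1] := @arg_minP _ _ _ d0 (fun d => p d != 0) room pd0.
have bounds d : p d != 0 -> (Num.floor (g d))%:~R < g d /\ g d < (Num.ceil (g d))%:~R.
  move=> /gN gd; have f1 := floor_le (g d); have c1 := ceil_ge (g d); split.
    rewrite lt_neqAle f1 andbT; apply: contra gd => /eqP <-; exact: intr_int.
  rewrite lt_neqAle c1 andbT; apply: contra gd => /eqP ->; exact: intr_int.
have roomP d : p d != 0 -> 0 < room d /\ forall e, 0 < e <= room d ->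
    (Num.floor (g d))%:~R <= g d + e * p d <= (Num.ceil (g d))%:~R.
  move=> pd; have [f1 c1] := bounds d pd; rewrite /room; case: (ltP 0 (p d)) => pd0'.
    split=> [|e]; first by rewrite divr_gt0 // subr_gt0.
    rewrite ler_pdivlMr // => /andP[e0 e1]; have := mulr_gt0 e0 pd0'; lra.
  have {pd0'} pdn : p d < 0 by rewrite lt_neqAle pd.
  split=> [|e]; first by rewrite ltr_ndivlMr // mul0r subr_lt0.
  rewrite ler_ndivlMr // => /andP[e0 e1]; have := mulr_gt0 e0 (_ : 0 < - p d);
    rewrite oppr_gt0 => /(_ pdn); lra.
exists (room d1); split=> [|d|]; first by case: (roomP d1 pd1).
  have [pd|pd] := eqVneq (p d) 0; first by rewrite pd mulr0 addr0 floor_le ceil_ge.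
  by apply: (roomP d pd).2; rewrite (roomP d1 pd1).1 min1.
exists d1 => //; rewrite /room; case: ifP => _; rewrite divfK // addrC subrK; exact: intr_int.
Qed.

(** Integrality of the transportation polytope: moving along a circulation on the non-integral
    entries keeps the margins, fixes the integral entries and makes a further entry integral. *)
Theorem integral_margins (g : D -> rat) :
  (forall d, 0 <= g d) ->
  (forall x, \sum_(d | tl d == x) g d \is a Num.int) ->
  (forall y, \sum_(d | hd d == y) g d \is a Num.int) ->
  exists g' : D -> nat,
    [/\ forall d, g d = 0 -> g' d = 0%N,
        forall x, \sum_(d | tl d == x) (g' d)%:R = \sum_(d | tl d == x) g d &
        forall y, \sum_(d | hd d == y) (g' d)%:R = \sum_(d | hd d == y) g d].
Proof.
have [n] := ubnP #|[set d | g d \isn't a Num.int]|.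
elim: n g => // n IH g gn g0 gt gh.
have [NE|N0] := eqVneq [set d | g d \isn't a Num.int] set0.
  have gint d : g d \is a Num.nat.
    by rewrite natrEint g0 andbT; move/setP/(_ d): NE; rewrite !inE => /negbFE.
  exists (fun d => Num.truncn (g d)); split=> [d ->|x|y]; first by rewrite truncn0.
    by apply: eq_bigr => d _; rewrite truncnK.
  by apply: eq_bigr => d _; rewrite truncnK.
have [p [pd pN pt ph]] := circulation N0 (fiber_card_ge2 erefl gt) (fiber_card_ge2 erefl gh).
have [|e [e0 eb [d1 pd1 ed1]]] := rounding_step (g := g) pd.
  by move=> d; apply: contraR; rewrite negbK => gd; rewrite pN // inE negbK.
have marg (Z : finType) (z : D -> Z) x : \sum_(d | z d == x) p d = 0 ->
    \sum_(d | z d == x) (g d + e * p d) = \sum_(d | z d == x) g d.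
  by move=> px; rewrite big_split /= -mulr_sumr px mulr0 addr0.
have stay d : g d \is a Num.int -> g d + e * p d = g d.
  by move=> gd; rewrite pN ?mulr0 ?addr0 // inE negbK.
have [||x|y|g' [g'0 g't g'h]] := IH (fun d => g d + e * p d).
- move: gn; rewrite ltnS; apply: leq_trans; apply: proper_card; apply/properP; split.
    by apply/subsetP => d; rewrite !inE; apply: contra => gd; rewrite stay.
  exists d1; rewrite !inE ?ed1 //; apply: contra pd1 => gd; by rewrite pN // inE negbK.
- move=> d; have /andP[fl _] := eb d; apply: le_trans fl; by rewrite ler0z floor_ge0.
- by rewrite marg.
- by rewrite marg.
exists g'; split=> [d gd|x|y]; last 2 first.
- by rewrite g't marg.
- by rewrite g'h marg.
by apply: g'0; rewrite stay // gd rpred0.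
Qed.

End Rounding.

Section SymmetricRounding.
Variables (V : finType).

(* Splitting each sided node into two copies and adding a slack arc per copy
   turns [f] into a fractional perfect matching with integral degrees of a
   graph; its bipartite double cover is rounded by [integral_margins]. *)
Lemma round_symmetric (sided : pred V) (sd : V -> V -> bool) (k : V -> nat)
    (f : V -> V -> rat) :
  (forall u v, f u v = f v u) -> (forall u v, 0 <= f u v) ->
  (forall v, sided v -> \sum_(u | sd v u) f v u = \sum_(u | ~~ sd v u) f v u) ->
  (forall v, sided v -> \sum_(u | sd v u) f v u <= (k v)%:R) ->
  (forall v, ~~ sided v -> \sum_u f v u <= (k v)%:R) ->
  exists n : V -> V -> nat,
    [/\ forall u v, n u v = n v u,
        forall u v, f u v = 0 -> n u v = 0%N,
        forall v, sided v -> (\sum_(u | sd v u) n v u = \sum_(u | ~~ sd v u) n v u)%N,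
        forall v, sided v -> (\sum_(u | sd v u) n v u <= 2 * k v)%N /\
          (\sum_(u | sd v u) f v u = (k v)%:R -> (\sum_(u | sd v u) n v u = 2 * k v)%N) &
        forall v, ~~ sided v -> [/\ (\sum_u n v u <= 2 * k v)%N, ~~ odd (\sum_u n v u) &
          \sum_u f v u = (k v)%:R -> (\sum_u n v u = 2 * k v)%N]].
Proof.
move=> fC f0 balance cap_sided cap_free.
pose side v u := if sided v then sd v u else true.
(* The slack arc of a sided node runs between its two copies, so both sides lose the same amount and
   stay balanced; at any other node it is a loop, counted twice, which makes the degree even. *)
pose flip v b := if sided v then ~~ b else b.
have flipK v : involutive (flip v) by move=> b; rewrite /flip; case: (sided v); rewrite ?negbK.
pose tl (d : V * V + V * bool) := match d with inl p => (p.1, side p.1 p.2) | inr q => q end.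
pose hd (d : V * V + V * bool) :=
  match d with inl p => (p.2, side p.2 p.1) | inr q => (q.1, flip q.1 q.2) end.
pose slack v b := if sided v then (k v)%:R - \sum_(u | sd v u) f v u
  else if b then (k v)%:R - \sum_u f v u else 0.
pose M v b := if sided v || b then k v else 0%N.
pose g (d : V * V + V * bool) := match d with inl p => f p.1 p.2 | inr q => slack q.1 q.2 end.
have tlE (R : nmodType) (y : V * V + V * bool -> R) v b : \sum_(d | tl d == (v, b)) y d =
    \sum_(u | side v u == b) y (inl (v, u)) + y (inr (v, b)).
  rewrite big_sumType /= big_pred1_eq; congr (_ + _).
  transitivity (\sum_(p : V * V | (p.1 == v) && (side p.1 p.2 == b)) y (inl (p.1, p.2))).
    by apply: eq_big => -[i u].
  rewrite -(pair_big_dep (pred1 v) (fun i u => side i u == b) (fun i u => y (inl (i, u)))) /=.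
  by rewrite big_pred1_eq.
have hdE (R : nmodType) (y : V * V + V * bool -> R) v b : \sum_(d | hd d == (v, b)) y d =
    \sum_(u | side v u == b) y (inl (u, v)) + y (inr (v, flip v b)).
  rewrite big_sumType /=; congr (_ + _); last first.
    rewrite (big_pred1 (v, flip v b)) // => -[v' b'] /=; rewrite !xpair_eqE.
    by case: eqP => //= ->; rewrite (can2_eq (flipK v) (flipK v)).
  have swapK : involutive (fun p : V * V => (p.2, p.1)) by case.
  rewrite (reindex_inj (inv_inj swapK)) /=.
  transitivity (\sum_(p : V * V | (p.1 == v) && (side p.1 p.2 == b)) y (inl (p.2, p.1))).
    by apply: eq_big => -[i u].
  rewrite -(pair_big_dep (pred1 v) (fun i u => side i u == b) (fun i u => y (inl (u, i)))) /=.
  by rewrite big_pred1_eq.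
have sumside v b : \sum_(u | side v u == b) f v u + slack v b = (M v b)%:R.
  rewrite /side /slack /M; case: (boolP (sided v)) => sv /=.
    case: b; first by rewrite addrC -[RHS](subrK (\sum_(u | sd v u) f v u)); congr (_ + _);
      apply: eq_bigl => u; rewrite eqb_id.
    rewrite (balance _ sv) addrC -[RHS](subrK (\sum_(u | ~~ sd v u) f v u)); congr (_ + _).
    by apply: eq_bigl => u; rewrite eqbF_neg.
  by case: b => /=; rewrite ?big_pred0_eq ?addr0 // addrC subrK.
have slack0 v b : 0 <= slack v b.
  rewrite /slack; case: (boolP (sided v)) => sv; first by rewrite subr_ge0 cap_sided.
  by case: b; rewrite ?subr_ge0 ?cap_free.
have slackE v b : slack v (flip v b) = slack v b by rewrite /slack /flip; case: (sided v).
have tlM x : \sum_(d | tl d == x) g d = (M x.1 x.2)%:R.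
  by case: x => v b; rewrite tlE sumside.
have hdM x : \sum_(d | hd d == x) g d = (M x.1 x.2)%:R.
  case: x => v b; rewrite hdE /= slackE -sumside; congr (_ + _).
  by apply: eq_bigr => u _; rewrite fC.
have [|x|x|g' [g'0 g't g'h]] := @integral_margins _ _ _ tl hd g.
- by case=> [p|q] /=.
- by rewrite tlM.
- by rewrite hdM.
(* Adding the two orientations restores symmetry; it is here that the flow doubles. *)
pose n u v := (g' (inl (u, v)) + g' (inl (v, u)))%N.
have sum_n v b : (\sum_(u | side v u == b) n v u + g' (inr (v, b)) + g' (inr (v, flip v b)) = 2 * M v b)%N.
  have Ht := g't (v, b); have Hh := g'h (v, b); move: Ht Hh.
  rewrite tlM hdM -!natr_sum => /eqP; rewrite eqr_nat tlE => /eqP Ht /eqP;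
    rewrite eqr_nat hdE => /eqP Hh.
  by rewrite big_split /= -addnA addnACA mul2n -addnn -{1}Ht -Hh.
have flip_sum v b : sided v -> (\sum_(u | side v u == b) n v u + g' (inr (v, true)) + g' (inr (v, false)) = 2 * k v)%N.
  move=> sv; have := sum_n v b; rewrite /M /flip sv /=; case: b => //= <-.
  by rewrite -!addnA; congr addn; rewrite addnC.
have sd_sum v : sided v -> (\sum_(u | side v u == true) n v u = \sum_(u | sd v u) n v u)%N /\
    (\sum_(u | side v u == false) n v u = \sum_(u | ~~ sd v u) n v u)%N.
  by move=> sv; split; apply: eq_bigl => u; rewrite /side sv ?eqb_id ?eqbF_neg.
exists n; split=> [u v|u v fuv|v sv|v sv|v sv].
- by rewrite /n addnC.
- by rewrite /n !g'0 //= fC.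
- have [<- <-] := sd_sum _ sv; have := flip_sum v true sv; have := flip_sum v false sv; lia.
- have [<- _] := sd_sum _ sv; have H := flip_sum v true sv; split=> [|fk]; first lia.
  have s0 b : g' (inr (v, b)) = 0%N by apply: g'0; rewrite /= /slack sv fk subrr.
  by move: H; rewrite !s0; lia.
- have H : (\sum_u n v u + g' (inr (v, true)) + g' (inr (v, true)) = 2 * k v)%N.
    have := sum_n v true; rewrite /flip /M (negbTE sv) /= => <-; congr (_ + _ + _)%N.
    by apply: eq_bigl => u; rewrite /side (negbTE sv).
  split=> [||fk]; [lia| |].
    have /(congr1 odd) := H; rewrite -addnA addnn mul2n oddD !odd_double addbF => ->.
    by [].
  have s0 : g' (inr (v, true)) = 0%N by apply: g'0; rewrite /= /slack (negbTE sv) fk subrr.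
  by move: H; rewrite s0; lia.
Qed.

End SymmetricRounding.

(** * Rounding with domination at central nodes *)

Section DominatedRounding.
Variables (V : finType) (T cen : pred V) (h : V -> V) (low : V -> V -> bool) (cap : V -> nat).

Lemma half_sum (I : finType) (R : realDomainType) (P : pred I) (F : I -> R) :
  (2%:R * \sum_(i | P i) F i == \sum_i F i) = (\sum_(i | P i) F i == \sum_(i | ~~ P i) F i).
Proof. by rewrite (bigID P predT) /= mulr_natl mulr2n (inj_eq (addrI _)). Qed.

(* [dir v = Some s] records that at the central node [v] exactly half of the
   flow comes from the side of [s], which makes [v] a balanced node like the
   noncentral ones. *)
Lemma round_directed (dir : V -> option V) (f : V -> V -> rat) :
  (forall u v, f u v = f v u) -> (forall u v, 0 <= f u v) ->
  (forall v, ~~ T v -> ~~ cen v -> \sum_(u | low v u) f v u = \sum_(u | ~~ low v u) f v u) ->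
  (forall v, ~~ T v -> cen v -> forall s, 2%:R * \sum_(u | h u == s) f v u <= \sum_u f v u) ->
  (forall v s, ~~ T v -> cen v -> dir v = Some s -> 2%:R * \sum_(u | h u == s) f v u = \sum_u f v u) ->
  (forall v, \sum_u f v u <= (if T v then cap v else 2 * cap v)%:R) ->
  exists n : V -> V -> nat,
    [/\ forall u v, n u v = n v u,
        forall u v, f u v = 0 -> n u v = 0%N,
        forall v, ~~ T v -> ~~ cen v -> (\sum_(u | low v u) n v u = \sum_(u | ~~ low v u) n v u)%N,
        forall v s, ~~ T v -> cen v -> dir v = Some s -> (2 * \sum_(u | h u == s) n v u = \sum_u n v u)%N &
        forall v, [/\ (\sum_u n v u <= 2 * if T v then cap v else 2 * cap v)%N,
          ~~ T v -> ~~ odd (\sum_u n v u) &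
          \sum_u f v u = (if T v then cap v else 2 * cap v)%:R ->
          (\sum_u n v u = 2 * if T v then cap v else 2 * cap v)%N]].
Proof.
move=> fC f0 bal dom dirE fcap.
pose sided v := ~~ T v && (~~ cen v || dir v).
pose sd v u := if cen v then dir v == Some (h u) else low v u.
(* At a sided inner node the bound applies to each of two equal sides, hence [cap v] instead of
   [2 * cap v]. *)
pose k v := if sided v || T v then cap v else (2 * cap v)%N.
have sided_bal v : sided v -> \sum_(u | sd v u) f v u = \sum_(u | ~~ sd v u) f v u.
  rewrite /sided /sd => /andP[vT]; case: (boolP (cen v)) => cv /=; last by rewrite bal.
  case E : (dir v) => [s|//] _; apply/eqP; rewrite -half_sum.
  rewrite (eq_bigl (fun u => h u == s)) ?(dirE v s) // => u; by rewrite (inj_eq Some_inj) eq_sym.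
have sumE v : sided v -> \sum_u f v u = 2%:R * \sum_(u | sd v u) f v u.
  by move=> sv; apply/esym/eqP; rewrite half_sum sided_bal.
have capE v : sided v -> T v = false /\ k v = cap v.
  by rewrite /k => sv; rewrite sv; move: sv => /andP[/negbTE ->].
have [||n [nC n0 nbal ncap nfree]] := @round_symmetric V sided sd k f fC f0 sided_bal.
- move=> v sv; have [vT kv] := capE v sv; have := fcap v; rewrite vT sumE // kv natrM.
  by rewrite ler_pM2l ?ltr0n.
- by move=> v; rewrite /k => sv; rewrite (negbTE sv) /=; exact: fcap.
have nsumE v : sided v -> (\sum_u n v u = 2 * \sum_(u | sd v u) n v u)%N.
  by move=> sv; rewrite (bigID (sd v)) /= -nbal // mul2n addnn.
exists n; split=> // [v vT cv|v s vT cv dv|v].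
- have sv : sided v by rewrite /sided vT cv.
  by have := nbal v sv; rewrite /sd (negbTE cv).
- have sv : sided v by rewrite /sided vT cv dv.
  rewrite nsumE //; congr (_ * _)%N; apply: eq_bigl => u.
  by rewrite /sd cv dv (inj_eq Some_inj) eq_sym.
case: (boolP (sided v)) => sv.
  have [vT kv] := capE v sv; have [le eq] := ncap v sv; rewrite vT nsumE //; split.
  - by rewrite leq_mul2l -kv.
  - by rewrite mul2n odd_double.
  by rewrite sumE // natrM => fE; rewrite eq ?kv //; apply: (mulfI _ fE); rewrite pnatr_eq0.
have [le ev eq] := nfree v sv.
by move: le eq; rewrite /k (negbTE sv).
Qed.

(** Each repetition gives a direction to one more node. Symmetry, balance, capacities, saturation
    and the earlier equalities pass from [f] to [n], hence to the point [f'] between [f] and half of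
    [n] from which rounding restarts. *)
Theorem dominated_rounding (f : V -> V -> rat) :
  (forall u v, f u v = f v u) -> (forall u v, 0 <= f u v) ->
  (forall v, ~~ T v -> ~~ cen v -> \sum_(u | low v u) f v u = \sum_(u | ~~ low v u) f v u) ->
  (forall v, ~~ T v -> cen v -> forall s, 2%:R * \sum_(u | h u == s) f v u <= \sum_u f v u) ->
  (forall v, \sum_u f v u <= (if T v then cap v else 2 * cap v)%:R) ->
  exists n : V -> V -> nat,
    [/\ forall u v, n u v = n v u,
        forall u v, f u v = 0 -> n u v = 0%N,
        forall v, ~~ T v -> ~~ cen v -> (\sum_(u | low v u) n v u = \sum_(u | ~~ low v u) n v u)%N,
        forall v, ~~ T v -> cen v -> forall s, (2 * \sum_(u | h u == s) n v u <= \sum_u n v u)%N &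
        forall v, [/\ (\sum_u n v u <= 2 * if T v then cap v else 2 * cap v)%N,
          ~~ T v -> ~~ odd (\sum_u n v u) &
          \sum_u f v u = (if T v then cap v else 2 * cap v)%:R ->
          (\sum_u n v u = 2 * if T v then cap v else 2 * cap v)%N]].
Proof.
move=> fC f0 bal dom fcap.
have [dir dirE] : exists dir : V -> option V, forall v s, ~~ T v -> cen v ->
    dir v = Some s -> 2%:R * \sum_(u | h u == s) f v u = \sum_u f v u.
  by exists (fun=> None).
have [m] := ubnP #|[set v | dir v == None]|.
elim: m => // m IH in dir f fC f0 bal dom fcap dirE * => dirm.
have [n [nC n0 nbal ndir ncap]] := round_directed fC f0 bal dom dirE fcap.
pose a (x : V * V) := \sum_u f x.1 u - 2%:R * \sum_(u | h u == x.2) f x.1 u.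
pose b (x : V * V) := (\sum_u n x.1 u)%:R / 2%:R - (\sum_(u | h u == x.2) n x.1 u)%:R : rat.
pose bad x := [&& ~~ T x.1, cen x.1 & b x < 0].
case: (pickP bad) => [x0 bad0|good]; last first.
  exists n; split=> // v vT cv s; have := good (v, s); rewrite /bad vT cv /= => /negbT.
  by rewrite -leNgt /b /= subr_ge0 ler_pdivlMr ?ltr0n // -natrM ler_nat mulnC.
have a0 x : bad x -> 0 <= a x by case/and3P=> xT xc _; rewrite subr_ge0 dom.
(* For a bad pair the slack runs linearly from [a x] to [b x] and vanishes at [th x]; stopping at
   the smallest such parameter keeps every domination inequality. *)
pose th x := a x / (a x - b x).
have [x1 bad1 min1] := @arg_minP _ _ _ x0 bad th bad0.
have [x1T x1c b1] := and3P bad1.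
have ab x : bad x -> 0 < a x - b x by move=> bx; have := a0 x bx; case/and3P: bx => _ _; lra.
set t := th x1 in min1 *.
have t0 : 0 <= t by rewrite divr_ge0 ?a0 // ltW // ab.
have t1 : t <= 1 by rewrite ler_pdivrMr ?ab // mul1r; lra.
have tE : t * (a x1 - b x1) = a x1 by rewrite divfK // gt_eqF // ab.
clearbody t.
pose f' u v := (1 - t) * f u v + t * ((n u v)%:R / 2%:R).
have lin v (P : pred V) : \sum_(u | P u) f' v u =
    (1 - t) * \sum_(u | P u) f v u + t * ((\sum_(u | P u) n v u)%:R / 2%:R).
  by rewrite big_split /= -!mulr_sumr -mulr_suml natr_sum.
have slackE x : \sum_u f' x.1 u - 2%:R * \sum_(u | h u == x.2) f' x.1 u = (1 - t) * a x + t * b x.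
  by rewrite !lin /a /b; field.
have f'0 u v : f u v = 0 -> f' u v = 0.
  by move=> fuv; rewrite /f' fuv n0 // mul0r !mulr0 addr0.
have [|||||||n' [n'C n'0 n'bal n'dom n'cap]] :=
    IH (fun v => if v == x1.1 then Some x1.2 else dir v) f'.
- by move=> u v; rewrite /f' fC nC.
- by move=> u v; rewrite addr_ge0 ?mulr_ge0 ?subr_ge0 ?divr_ge0 ?ler0n.
- by move=> v vT cv; rewrite !lin bal // nbal.
- move=> v vT cv s; rewrite -subr_ge0 (slackE (v, s)).
  have : 0 <= a (v, s) by rewrite subr_ge0 dom.
  case: (leP 0 (b (v, s))) => [bx ax|bx _].
    by rewrite addr_ge0 ?mulr_ge0 // subr_ge0.
  have badx : bad (v, s) by rewrite /bad vT cv bx.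
  have := min1 _ badx; rewrite /th ler_pdivlMr ?ab //; lra.
- move=> v; rewrite lin; have fv := fcap v; have [nv _ _] := ncap v.
  move: nv; rewrite -(ler_nat rat) natrM => nv.
  set A := \sum_u f v u in fv *; set K := (_%:R : rat) in fv nv *; set N := (_%:R : rat) in nv *.
  have : 0 <= (1 - t) * (K - A) by rewrite mulr_ge0 ?subr_ge0.
  have : 0 <= t * (2%:R * K - N) by rewrite mulr_ge0 ?subr_ge0.
  lra.
- move=> v s vT cv; case: eqP => [-> [<-]|_ dv].
    apply/esym/eqP; rewrite -subr_eq0 slackE; apply/eqP; lra.
  by rewrite !lin -(dirE v s vT cv dv) -(ndir v s vT cv dv) natrM; field.
- move: dirm; rewrite ltnS; apply: leq_trans; apply: proper_card; apply/properP; split.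
    by apply/subsetP => v; rewrite !inE; case: (v == x1.1).
  (* The chosen node had no direction before: where one home carries exactly half of [n], no other
     carries more than half, so the node would not be bad. *)
  exists x1.1; rewrite !inE ?eqxx //; case E: (dir x1.1) => [s1|//].
  have D1 := ndir _ _ x1T x1c E; move: b1.
  rewrite /b ltNge subr_ge0 ler_pdivlMr ?ltr0n // -natrM ler_nat mulnC => /negP[].
  have [<-|s12] := eqVneq s1 x1.2; first by rewrite D1.
  have := D1; rewrite [X in _ = X](bigID (fun u => h u == s1)) /= => D2.
  have : (\sum_(u | h u == x1.2) n x1.1 u <= \sum_(u | h u != s1) n x1.1 u)%N.
    rewrite [leqLHS]big_mkcond [leqRHS]big_mkcond; apply: leq_sum => u _.
    by case: eqP => // ->; rewrite eq_sym s12.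
  by move: D1 D2; move: (\sum_(u | _) _)%N (\sum_(u | _) _)%N (\sum_(u | _) _)%N (\sum_u _)%N; lia.
exists n'; split=> // [u v /f'0/n'0 //|v].
have [n'le n'ev n'eq] := n'cap v; split=> // fE; apply: n'eq; rewrite lin fE.
by have [_ _ ->] := ncap v; rewrite // natrM; field.
Qed.

End DominatedRounding.

(** * Tight walks *)

Section TerminalWalks.
Variables (V : finType) (adj : rel V) (T : pred V) (w : V -> rat) (lam : rat).
Hypotheses (adjC : symmetric adj) (w_gt0 : forall v, 0 < w v).

Definition wt (q : seq V) := \sum_(v <- q) w v.

Lemma wt_nil : wt [::] = 0. Proof. by rewrite /wt big_nil. Qed.
Lemma wt_cons v q : wt (v :: q) = w v + wt q. Proof. by rewrite /wt big_cons. Qed.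
Lemma wt_cat q1 q2 : wt (q1 ++ q2) = wt q1 + wt q2. Proof. by rewrite /wt big_cat. Qed.
Lemma wt_rcons q v : wt (rcons q v) = wt q + w v.
Proof. by rewrite -cats1 wt_cat wt_cons wt_nil addr0. Qed.
Lemma wt_rev q : wt (rev q) = wt q.
Proof. by rewrite /wt; apply: perm_big; rewrite perm_rev. Qed.
Lemma wt_ge0 q : 0 <= wt q.
Proof. by apply: sumr_ge0 => v _; exact: ltW. Qed.

(** Repeated nodes and terminals in the interior are allowed, so that walks can be cut and
    recombined freely; minimality excludes both from tight walks. *)
Definition connecting (q : seq V) :=
  if q is x :: q' then [&& path adj x q', T x, T (last x q') & x != last x q'] else false.

Lemma connectingE q1 v q2 : connecting (q1 ++ v :: q2) =
  [&& sorted adj (rcons q1 v), path adj v q2, T (head v q1), T (last v q2) & head v q1 != last v q2].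
Proof.
case: q1 => [|x q1] //=.
by rewrite cat_path rcons_path last_cat /= -!andbA.
Qed.

Lemma head_rev (x : V) q : head x (rev q) = last x q.
Proof. by case/lastP: q => // q y; rewrite rev_rcons last_rcons. Qed.

Lemma last_rev (x : V) q : last x (rev q) = head x q.
Proof. by rewrite -head_rev revK. Qed.

Lemma connecting_rev q : connecting (rev q) = connecting q.
Proof.
case: q => // x q; rewrite rev_cons -cats1 connectingE /= head_rev -rev_cons.
rewrite rev_sorted /= (eq_path (e' := adj)) => [|a b]; last by rewrite adjC.
by rewrite (eq_sym x); case: (T x); rewrite ?andbF ?andbT.
Qed.

Definition tight q := connecting q && (wt q == lam).

Lemma tight_rev q : tight (rev q) = tight q.
Proof. by rewrite /tight connecting_rev wt_rev. Qed.

Lemma tight_rev_mid q1 v q2 : tight (q1 ++ v :: q2) -> tight (rev q2 ++ v :: rev q1).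
Proof. by rewrite -tight_rev rev_cat rev_cons cat_rcons. Qed.

Lemma connecting_swap p1 p2 q1 q2 v :
  connecting (p1 ++ v :: p2) -> connecting (q1 ++ v :: q2) ->
  head v p1 != last v q2 -> connecting (p1 ++ v :: q2).
Proof. by rewrite !connectingE => /and5P[-> _ -> _ _] /and5P[_ -> _ -> _] ->. Qed.

Lemma connecting_cut q1 v q2 q3 :
  connecting (q1 ++ v :: q2 ++ v :: q3) -> connecting (q1 ++ v :: q3).
Proof.
rewrite !connectingE cat_path last_cat /= => /and5P[-> + -> -> ->].
by case/and3P=> _ _ ->.
Qed.

Lemma not_uniq_split (q : seq V) :
  ~~ uniq q -> exists q1 v q2 q3, q = q1 ++ v :: q2 ++ v :: q3.
Proof.
elim: q => //= x q IH; rewrite negb_and negbK => /orP[|/IH[q1 [v [q2 [q3 ->]]]]].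
  by case/splitPr=> q2 q3; exists [::], x, q2, q3.
by exists (x :: q1), v, q2, q3.
Qed.

Lemma wt_cut q1 v q2 q3 : wt (q1 ++ v :: q3) < wt (q1 ++ v :: q2 ++ v :: q3).
Proof. by rewrite !(wt_cat, wt_cons); have := w_gt0 v; have := wt_ge0 q2; lra. Qed.

(** The two ends of the walk differ, so one of them differs from the terminal [v], and the part
    between that end and [v] is connecting. *)
Lemma connecting_inner q1 v q2 : q1 != [::] -> q2 != [::] -> T v ->
  connecting (q1 ++ v :: q2) ->
  exists q, [/\ connecting q, wt q < wt (q1 ++ v :: q2) & (size q < size (q1 ++ v :: q2))%N].
Proof.
move=> q10 q20 vT; rewrite connectingE => /and5P[s1 s2 T1 T2 h12].
have [hv|hv] := eqVneq (head v q1) v.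
  exists (v :: q2); split; first by rewrite /= s2 vT T2 -{1}hv.
  - rewrite wt_cat ltrDr; case: q1 q10 {s1 T1 h12 hv} => // x q1 _.
    by rewrite wt_cons; have := w_gt0 x; have := wt_ge0 q1; lra.
  by rewrite size_cat; case: q1 q10 {s1 T1 h12 hv} => //= x q1 _; rewrite ltnS leq_addl.
exists (q1 ++ [:: v]); split; first by rewrite connectingE s1 T1 /= vT.
- rewrite !wt_cat !wt_cons wt_nil; case: q2 q20 {s2 T2 h12} => // x q2 _.
  by rewrite wt_cons; have := w_gt0 x; have := wt_ge0 q2; lra.
by rewrite !size_cat ltn_add2l; case: q2 q20 {s2 T2 h12} => //= x q1 _.
Qed.

Hypothesis lam_le : forall q, connecting q -> lam <= wt q.

Lemma tight_uniq q : tight q -> uniq q.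
Proof.
case/andP=> + /eqP wq; apply: contraLR => /not_uniq_split[q1 [v [q2 [q3 qE]]]].
apply/negP; rewrite qE => /connecting_cut/lam_le.
by rewrite -wq qE leNgt wt_cut.
Qed.

Lemma tight_inner q1 v q2 : q1 != [::] -> q2 != [::] -> tight (q1 ++ v :: q2) -> ~~ T v.
Proof.
move=> q10 q20 /andP[cq /eqP wq]; apply/negP => vT.
have [q [/lam_le + wlt _]] := connecting_inner q10 q20 vT cq.
by rewrite -wq leNgt wlt.
Qed.

(* The positions of [v] on the tight walks through it: either [v] always lies
   exactly in the middle, or there is a terminal [h] such that every tight walk
   through [v] reaches it from [h] after the same length [p]. *)
Lemma arms_exist v : exists x : rat * V * bool, let: (p, h, cen) := x in 0 <= p /\
  forall q1 q2, tight (q1 ++ v :: q2) -> if cen then wt q1 = p /\ wt q2 = p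
  else 2%:R * p + w v < lam /\ ((head v q1 = h /\ wt q1 = p) \/ (last v q2 = h /\ wt q2 = p)).
Proof.
(* A tight walk with unequal arms at [v] determines the home: its nearer end. *)
have [[p1 [p2 [tp lt12]]]|none] :=
    classic (exists p1 p2, tight (p1 ++ v :: p2) /\ wt p1 < wt p2).
  exists (wt p1, head v p1, false); split=> [|q1 q2 tq]; first exact: wt_ge0.
  (* Following one tight walk up to [v] and another one from there on gives a connecting walk if the
     ends differ, and it cannot be lighter than [lam]. *)
  have swap a1 a2 b1 b2 : tight (a1 ++ v :: a2) -> tight (b1 ++ v :: b2) ->
      head v a1 != last v b2 -> wt b1 <= wt a1.
    case/andP=> ca _ /andP[cb /eqP]; rewrite wt_cat wt_cons => wb /(connecting_swap ca cb)/lam_le.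
    rewrite wt_cat wt_cons; lra.
  have tpr := tight_rev_mid tp; have tqr := tight_rev_mid tq.
  have := swap _ _ _ _ tp tq; have := swap _ _ _ _ tq tp.
  have := swap _ _ _ _ tp tqr; have := swap _ _ _ _ tqr tp.
  rewrite !head_rev !last_rev !wt_rev.
  have [/andP[+ /eqP wp] /andP[+ /eqP wq]] := (tp, tq).
  rewrite !connectingE => /and5P[_ _ _ _ hp] /and5P[_ _ _ _ hq].
  rewrite !wt_cat !wt_cons in wp wq.
  move=> s1 s2 s3 s4; split; first by lra.
  have [e1|n1] := eqVneq (head v p1) (head v q1).
    by left; split=> //; apply/eqP; rewrite eq_le s4 ?s3 // -?e1 // e1.
  have [e2|n2] := eqVneq (head v p1) (last v q2).
    right; split=> //; apply/eqP; rewrite eq_le s2 // s1 // -e2 //.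
  by have := s4 n2; have := s2 n1; lra.
(* Here the arms of every tight walk through [v] have equal weight. The absolute value keeps [p]
   nonnegative even when there is no such walk; [v] as home is a placeholder. *)
exists (`|(lam - w v) / 2%:R|, v, true); split=> // q1 q2 tq.
have le21 : wt q2 <= wt q1 by rewrite leNgt; apply/negP => lt; apply: none; exists q1, q2.
have le12 : wt q1 <= wt q2.
  rewrite leNgt; apply/negP => lt; apply: none; exists (rev q2), (rev q1).
  by rewrite !wt_rev; split=> //; exact: tight_rev_mid.
case/andP: tq => _ /eqP; rewrite wt_cat wt_cons => wq.
have wq1 := wt_ge0 q1; rewrite ger0_norm /=; last lra.
by split; lra.
Qed.

Variables (p : V -> rat) (h : V -> V) (cen : pred V).
Hypotheses (p_ge0 : forall v, 0 <= p v)
  (arms : forall v q1 q2, tight (q1 ++ v :: q2) ->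
    if cen v then wt q1 = p v /\ wt q2 = p v
    else 2%:R * p v + w v < lam /\
      ((head v q1 = h v /\ wt q1 = p v) \/ (last v q2 = h v /\ wt q2 = p v))).

(* An edge of a tight walk either leads away from the terminal [h] common to both
   ends, or reaches a central node, or joins nodes with different terminals. *)
Definition climbs u v := [&& ~~ cen u, ~~ cen v, h u == h v & p v == p u + w u].
Definition summits u v := [&& ~~ cen u, cen v, p v == p u + w u & 2%:R * p v + w v == lam].
Definition crosses u v := [&& ~~ cen u, ~~ cen v, h u != h v & p u + w u + w v + p v == lam].
(** The labels of a terminal that no tight walk visits are arbitrary, so every edge has to record
    that its terminals carry the expected ones. *)
Definition based u := T u ==> [&& p u == 0, h u == u & ~~ cen u].
Definition tight_edge u v := [&& adj u v, based u, based v &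
  [|| climbs u v, climbs v u, summits u v, summits v u | crosses u v]].
Definition low v u := climbs u v.

Lemma tight_edgeC : symmetric tight_edge.
Proof.
move=> u v; rewrite /tight_edge adjC; case: (adj v u) => //=.
rewrite andbCA; do 2 case: (based _) => //=.
rewrite /crosses [in RHS]eq_sym.
have -> : p v + w v + w u + p u = p u + w u + w v + p v by ring.
case: (climbs u v); case: (climbs v u) => //=; case: (summits u v); case: (summits v u) => //=.
by do 2 case: (cen _).
Qed.

(* [lra] fails on equations between nodes. *)
Ltac node_lra :=
  repeat match goal with
  | H : ~ _ |- _ => clear H
  | H : @eq (Equality.sort V) _ _ |- _ => clear H
  | H : @eq (Finite.sort V) _ _ |- _ => clear H
  end; lra.

(** [s] and [t] are the ends of a tight walk that steps from [u] to [v], and [x] and [y] its weights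
    before [u] and after [v]. The walk climbs away from [s], turns once, at a central node or on a
    crossing edge, and descends to [t]. *)
Variant edge_spec (s t : V) (x y : rat) (u v : V) : Prop :=
| EdgeSummitL of cen u & ~~ cen v & h v = t & p v = y & p u = x & x = w v + y
| EdgeSummitR of ~~ cen u & cen v & h u = s & p u = x & p v = y & y = x + w u
| EdgeUp of ~~ cen u & ~~ cen v & h u = s & p u = x & h v = s & p v = x + w u & x + w u < y
| EdgeCross of ~~ cen u & ~~ cen v & h u = s & p u = x & h v = t & p v = y & x < w v + y &
  y < x + w u
| EdgeDown of ~~ cen u & ~~ cen v & h u = t & p u = w v + y & h v = t & p v = y & w v + y < x.

Lemma edgeP q1 u v q2 : tight (q1 ++ u :: v :: q2) ->
  [/\ head u q1 <> last v q2, wt q1 + w u + w v + wt q2 = lam &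
    edge_spec (head u q1) (last v q2) (wt q1) (wt q2) u v].
Proof.
move=> tq; have au := arms tq; move: (tq); rewrite -cat_rcons => /arms av.
case/andP: tq; rewrite connectingE => /and5P[_ _ _ _ /eqP st] /eqP.
rewrite !(wt_cat, wt_rcons, wt_cons) => wE.
have {}av : if cen v then wt q1 + w u = p v /\ wt q2 = p v
    else 2%:R * p v + w v < lam /\ ((head u q1 = h v /\ wt q1 + w u = p v) \/ (last v q2 = h v /\ wt q2 = p v)).
  by move: av; rewrite wt_rcons; case: (q1).
move: au; rewrite /= wt_cons => au.
have wu := w_gt0 u; have wv := w_gt0 v.
split=> //; first by node_lra.
case: (boolP (cen u)) au => cu; case: (boolP (cen v)) av => cv.
- by move=> [v1 v2] [u1 u2]; node_lra.
- move=> [v0 [[v1 v2]|[v1 v2]]] [u1 u2]; first node_lra.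
  by apply: EdgeSummitL => //; node_lra.
- move=> [v1 v2] [u0 [[u1 u2]|[u1 u2]]]; last node_lra.
  by apply: EdgeSummitR => //; node_lra.
move=> [v0 [[v1 v2]|[v1 v2]]] [u0 [[u1 u2]|[u1 u2]]].
- by apply: EdgeUp => //; node_lra.
- node_lra.
- by apply: EdgeCross => //; node_lra.
- by apply: EdgeDown => //; node_lra.
Qed.

Lemma based_head v q2 : tight (v :: q2) -> based v.
Proof.
move=> tq; apply/implyP => _.
have := @arms v [::] q2 tq; have w0 := wt_nil; case/andP: tq.
rewrite -[v :: q2]/([::] ++ v :: q2) connectingE /= => /and4P[_ _ _ /eqP vl] /eqP.
rewrite wt_cons wt_nil => wE; have w2 : 0 < wt q2.
  case: (q2) vl => //= x q _; rewrite wt_cons; have := w_gt0 x; have := wt_ge0 q; node_lra.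
have wv := w_gt0 v.
case: (cen v) => [[p0 p1]|[p1 [[<- <-]|[_ p2]]]]; rewrite ?eqxx ?w0 ?eqxx //; node_lra.
Qed.

Lemma based_tight q1 v q2 : tight (q1 ++ v :: q2) -> based v.
Proof.
case: q1 => [|x q1]; first exact: based_head.
case: q2 => [/tight_rev_mid /= /based_head //|y q2 tq].
by apply/implyP => vT; have := tight_inner (isT : x :: q1 != [::]) (isT : y :: q2 != [::]) tq;
  rewrite vT.
Qed.

Lemma tight_edge_tight q1 u v q2 : tight (q1 ++ u :: v :: q2) -> tight_edge u v.
Proof.
move=> tq; rewrite /tight_edge (based_tight tq).
have := tq; rewrite -cat_rcons => /based_tight ->.
have -> : adj u v.
  by move: tq; rewrite /tight connectingE /= => /andP[/and5P[_ /andP[->]]].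
have [st wE] := edgeP tq; case=> cu cv /=.
- move=> hv pv pu xE; suff -> : summits v u by rewrite !orbT.
  by rewrite /summits cu cv pu pv -wE; apply/and4P; split=> //; apply/eqP; node_lra.
- move=> hv pv pu xE; suff -> : summits u v by rewrite !orbT.
  by rewrite /summits cu cv pu pv -wE; apply/and4P; split=> //; apply/eqP; node_lra.
- by move=> hu pu hv pv lt; rewrite /climbs cu cv hu hv pu pv !eqxx.
- move=> hu pu hv pv l1 l2; suff -> : crosses u v by rewrite !orbT.
  by rewrite /crosses cu cv hu hv pu pv -wE eqxx andbT; apply/eqP.
- move=> hu pu hv pv lt; suff -> : climbs v u by rewrite !orbT.
  by rewrite /climbs cu cv hu hv pu pv addrC !eqxx.
Qed.

Lemma low_prev q1 u v q2 : tight (q1 ++ u :: v :: q2) -> ~~ cen v ->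
  low v u = (wt q1 + w u == p v).
Proof.
case/edgeP=> st wE; rewrite /low /climbs => + cv; have wu := w_gt0 u; have wv := w_gt0 v.
rewrite cv /=; case=> cu cv'.
- by move=> _ pv pu xE; rewrite cu; apply/esym/eqP => ?; node_lra.
- by rewrite cv' in cv.
- by move=> -> pu -> pv _; rewrite cu pu pv !eqxx.
- move=> hu pu hv pv lt1 lt2; rewrite hu hv (introF eqP st) andbF.
  by apply/esym/eqP => ?; node_lra.
- move=> hu pu hv pv lt; have -> : (p v == p u + w u) = false by apply/eqP => ?; node_lra.
  by rewrite !andbF; apply/esym/eqP => ?; node_lra.
Qed.

Lemma low_next q1 u v q2 : tight (q1 ++ u :: v :: q2) -> ~~ cen u ->
  low u v = (w v + wt q2 == p u).
Proof.
move=> tq cu; have := tight_rev_mid (etrans (congr1 tight (cat_rcons _ _ _)) tq).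
by rewrite rev_rcons => /low_prev -> //; rewrite wt_rev addrC.
Qed.

(** Exactly one arm at a noncentral node has weight [p v], because [2 * p v + w v < lam]; the
    neighbour on that arm is the low one. *)
Lemma low_xor q1 a v b q2 : tight (rcons q1 a ++ v :: b :: q2) -> ~~ cen v ->
  low v a = ~~ low v b.
Proof.
move=> tq cv; rewrite (low_next tq) //.
have := arms tq; have := edgeP tq; rewrite (negbTE cv).
move: tq; rewrite cat_rcons => /low_prev -> // [_ wE _] [lt ar].
move: wE ar; rewrite wt_rcons wt_cons => wE [[_ e]|[_ e]].
  by rewrite e eqxx; apply/esym/eqP => ?; node_lra.
by rewrite e eqxx; apply/eqP => ?; node_lra.
Qed.

(** Each neighbour of a central node on a tight walk has the end on its own side as home, and the
    two ends differ. *)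
Lemma home_neq q1 a v b q2 : tight (rcons q1 a ++ v :: b :: q2) -> cen v -> h a != h b.
Proof.
move=> tq cv; have := edgeP tq; move: tq; rewrite cat_rcons => /edgeP.
case=> st _ e1 [_ _ e2]; have wv := w_gt0 v.
have -> : h a = head a q1 by case: e1 => // _; rewrite ?cv.
have -> : h b = last b q2 by case: e2 => // ; rewrite ?cv.
exact/eqP.
Qed.

(** * Edge flows of tight walks *)

Fixpoint hops (q : seq V) (u v : V) : nat :=
  if q is a :: q' then
    if q' is b :: _ then ((u == a) && (v == b)) + ((u == b) && (v == a)) + hops q' u v else 0
  else 0.

Lemma hopsC q u v : hops q u v = hops q v u.
Proof.
elim: q => // a [|b q] IH //=; move: IH => /= ->.
by congr (_ + _)%N; rewrite addnC ![(_ == a) && _]andbC.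
Qed.

Lemma hops_notin q u v : u \notin q -> hops q u v = 0%N.
Proof.
elim: q => // a [|b q] IH //; rewrite inE negb_or => /andP[ua uq].
rewrite [LHS]/= [X in (_ + X)%N]IH // (negbTE ua) /= addn0.
by move: uq; rewrite inE negb_or => /andP[/negbTE ->].
Qed.

Lemma hops_cat q1 v q2 a b : hops (q1 ++ v :: q2) a b = (hops (rcons q1 v) a b + hops (v :: q2) a b)%N.
Proof.
elim: q1 => [|x q1 IH] //; case: q1 IH => [|y q1] IH; first by rewrite /= addn0.
by move: IH => /= ->; rewrite addnA.
Qed.

Lemma hops_head v b q u : v \notin b :: q -> hops (v :: b :: q) v u = (u == b).
Proof.
move=> vq; rewrite [LHS]/= eqxx /= [X in (_ + X)%N](hops_notin u vq).
by move: vq; rewrite inE negb_or => /andP[/negbTE -> _] /=; rewrite !addn0.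
Qed.

Lemma hops_last q a v u : v \notin rcons q a -> hops (rcons (rcons q a) v) v u = (u == a).
Proof.
move=> vq; rewrite -[rcons (rcons q a) v]cats1 cat_rcons hops_cat hops_notin // add0n /= eqxx /=.
have /negbTE -> : v != a by apply: contra vq => /eqP ->; rewrite mem_rcons mem_head.
by rewrite /= addn0.
Qed.

Lemma hops_inner q1 a v b q2 u : uniq (rcons q1 a ++ v :: b :: q2) ->
  hops (rcons q1 a ++ v :: b :: q2) v u = ((u == a) + (u == b))%N.
Proof.
rewrite cat_uniq => /and3P[_ H /andP[vq _]]; rewrite hops_cat hops_last ?hops_head //.
by apply: contra H => va; apply/hasP; exists v => //; rewrite mem_head.
Qed.

Lemma hops_gt0 q u v : (0 < hops q u v)%N ->
  exists q1 q2, q = q1 ++ u :: v :: q2 \/ q = q1 ++ v :: u :: q2.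
Proof.
elim: q => // a [|b q] IH //; rewrite [hops _ _ _]/=.
case: (boolP ((u == a) && (v == b))) => [/andP[/eqP -> /eqP ->] _|_]; first by exists [::], q; left.
case: (boolP ((u == b) && (v == a))) => [/andP[/eqP -> /eqP ->] _|_]; first by exists [::], q;
  right.
rewrite !add0n => /IH[q1 [q2 [->|->]]]; exists (a :: q1), q2; by [left|right].
Qed.

Lemma hops_edge q u v : tight q -> (0 < hops q u v)%N -> tight_edge u v.
Proof.
move=> tq /hops_gt0[q1 [q2 [] qE]]; move: tq; rewrite qE => /tight_edge_tight //.
by rewrite tight_edgeC.
Qed.

Lemma tight_node q v : tight q -> v \in q ->
  (T v /\ exists b, forall u, hops q v u = (u == b)) \/
  (~~ T v /\ exists q1 a b q2, q = rcons q1 a ++ v :: b :: q2).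
Proof.
move=> tq; have uq := tight_uniq tq => /splitPr vq; case: vq tq uq => q1 q2 tq uq.
have : connecting (q1 ++ v :: q2) by case/andP: tq.
rewrite connectingE => /and5P[_ _ T1 T2 st].
case/lastP: q1 => [|q1 a] in tq uq T1 T2 st *.
  case: q2 => [|b q2] in tq uq T1 T2 st *; first by rewrite eqxx in st.
  by left; split=> //; exists b => u; apply: hops_head; case/andP: uq.
case: q2 => [|b q2] in tq uq T1 T2 st *.
  left; split=> //; exists a => u; rewrite cats1 hops_last //.
  by move: uq; rewrite cats1 rcons_uniq => /andP[].
right; split; last by exists q1, a, b, q2.
by apply: tight_inner tq => //; case: (q1).
Qed.

Lemma sum_eq_op (P : pred V) b : (\sum_(u | P u) (u == b) = P b)%N.
Proof.
rewrite big_mkcond (bigD1 b) //= eqxx big1 ?addn0 => [|u /negbTE ->]; by case: (P _).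
Qed.

(** A tight walk is simple and meets terminals only at its ends. Hence a load bound becomes the same
    degree bound at terminals and twice that bound at inner nodes. *)
Lemma hops_degree q v : tight q ->
  (\sum_u hops q v u = (v \in q) * if T v then 1 else 2)%N.
Proof.
move=> tq; have [vq|vq] := boolP (v \in q); last first.
  by rewrite big1 // => u _; rewrite hops_notin.
have [[-> [b bE]]|[/negbTE -> [q1 [a [b [q2 qE]]]]]] := tight_node tq vq.
  by rewrite (eq_bigr _ (fun u _ => bE u)) sum_eq_op.
have uq := tight_uniq tq; rewrite qE in uq *.
by rewrite (eq_bigr _ (fun u _ => hops_inner u uq)) big_split /= !sum_eq_op.
Qed.

Lemma hops_balanced q v : tight q -> ~~ T v -> ~~ cen v ->
  (\sum_(u | low v u) hops q v u = \sum_(u | ~~ low v u) hops q v u)%N.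
Proof.
move=> tq vT cv; have [vq|vq] := boolP (v \in q); last first.
  by rewrite !big1 // => u _; rewrite hops_notin.
have [[vT' _]|[_ [q1 [a [b [q2 qE]]]]]] := tight_node tq vq; first by rewrite vT' in vT.
have uq := tight_uniq tq; rewrite qE in uq tq *.
rewrite !(eq_bigr _ (fun u _ => hops_inner u uq)) !big_split /= !sum_eq_op.
by rewrite (low_xor tq cv); case: (low v b).
Qed.

Lemma hops_dominated q v s : tight q -> ~~ T v -> cen v ->
  (2 * \sum_(u | h u == s) hops q v u <= \sum_u hops q v u)%N.
Proof.
move=> tq vT cv; have [vq|vq] := boolP (v \in q); last first.
  by rewrite big1 // => u _; rewrite hops_notin.
have [[vT' _]|[_ [q1 [a [b [q2 qE]]]]]] := tight_node tq vq; first by rewrite vT' in vT.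
have uq := tight_uniq tq; rewrite qE in uq tq *.
rewrite !(eq_bigr _ (fun u _ => hops_inner u uq)) !big_split /= !sum_eq_op.
have := home_neq tq cv; case: (h a =P s) => [->|_]; last by case: (_ == s).
by rewrite eq_sym => /negbTE ->.
Qed.

Lemma hops_le1 q u v : tight q -> (hops q u v <= 1)%N.
Proof.
move=> tq; have [uq|uq] := boolP (u \in q); last by rewrite hops_notin.
have [[_ [b ->]]|[_ [q1 [a [b [q2 qE]]]]]] := tight_node tq uq; first by case: eqP.
have uniqq := tight_uniq tq; rewrite qE in uniqq *; rewrite hops_inner //.
case: (v =P a) => [->|_]; last by case: (v == b).
case: eqP => // ab; move: uniqq; rewrite cat_uniq => /and3P[_ /hasP[]].
by exists b; rewrite ?inE ?eqxx ?orbT // -ab mem_rcons mem_head.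
Qed.

(** * Decomposing integer edge flows into tight walks *)

Section Decomposition.

(** Sums of tight walks have these properties, and together they suffice for a decomposition. Parity
    is stated at central nodes; at the other inner nodes balance implies it. *)
Definition admissible (n : V -> V -> nat) : Prop :=
  [/\ forall u v, n u v = n v u,
      forall u v, (0 < n u v)%N -> tight_edge u v,
      forall v, ~~ T v -> ~~ cen v -> (\sum_(u | low v u) n v u = \sum_(u | ~~ low v u) n v u)%N,
      forall v, ~~ T v -> cen v -> forall s, (2 * \sum_(u | h u == s) n v u <= \sum_u n v u)%N &
      forall v, ~~ T v -> cen v -> ~~ odd (\sum_u n v u)].

Lemma psum_exists (I : finType) (P : pred I) (F : I -> nat) :
  (0 < \sum_(i | P i) F i)%N -> exists2 i, P i & (0 < F i)%N.
Proof.
rewrite lt0n => sum0; have [i /andP[Pi Fi]|none] := pickP (fun i => P i && (0 < F i)%N).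
  by exists i.
by rewrite big1 ?eqxx // in sum0 => i Pi; have := none i; rewrite Pi lt0n => /negbFE/eqP.
Qed.

Lemma sum_ge_term (I : finType) (P : pred I) (F : I -> nat) i :
  P i -> (F i <= \sum_(j | P j) F j)%N.
Proof. by move=> Pi; rewrite (bigD1 i) //= leq_addr. Qed.

Lemma climbs_asym u v : climbs u v -> ~~ climbs v u.
Proof.
case/and4P=> cu cv /eqP huv /eqP e1; apply/negP => /and4P[_ _ _ /eqP e2].
have := w_gt0 u; have := w_gt0 v; node_lra.
Qed.

(** This provides a place to start a walk: no edge climbs in both directions, and summit and
    crossing edges are low at neither end. *)
Lemma high_end u v : tight_edge u v ->
  (~~ cen u && ~~ low u v) || (~~ cen v && ~~ low v u).
Proof.
have half a b : [|| climbs a b, summits a b | crosses a b] -> ~~ cen a && ~~ low a b.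
  case/or3P=> H; have ca : ~~ cen a by [case/and4P: H]; rewrite ca /low.
  - exact: climbs_asym.
  - by rewrite /climbs; case/and4P: H => _ ->; rewrite ?andbF.
  - by rewrite /climbs; case/and4P: H => _ _ nh _; rewrite eq_sym (negbTE nh) !andbF.
case/and4P=> _ _ _ /or4P[H|H|H|/orP[H|H]].
- by rewrite half // H.
- by rewrite orbC half // H.
- by rewrite half // H orbT.
- by rewrite orbC half // H orbT.
- by rewrite half // H !orbT.
Qed.

Variable n : V -> V -> nat.
Hypothesis adm : admissible n.

Definition used : rel V := [rel u v | (0 < n u v)%N].

Lemma usedC : symmetric used.
Proof. by case: adm => nC _ _ _ _ u v; rewrite /used /= nC. Qed.

Lemma used_edge u v : used u v -> tight_edge u v.
Proof. by case: adm => _ + _ _ _; apply. Qed.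

Lemma used_based u v : used u v -> based u.
Proof. by move/used_edge; case/and4P. Qed.

(** By balance, a used edge that is not low forces a used low edge, to a node with smaller [p] and
    the same home; the descent can stop only at a terminal, which is its own home. *)
Lemma descent u x : ~~ cen u -> used u x -> ~~ low u x ->
  exists d, [/\ path used u d, wt d = p u, T (last u d), last u d = h u & all (predC cen) d].
Proof.
have [m] := ubnP #|[set v | p v < p u]|.
elim: m u x => // m IH u x um cu ux lux.
have [uT|uT] := boolP (T u).
  have := used_based ux; rewrite /based uT => /and3P[/eqP pu /eqP hu _].
  by exists [::]; rewrite wt_nil pu.
have [y yu uy] : exists2 y, low u y & used u y.
  apply: psum_exists; case: adm => _ _ -> // _ _.
  exact: leq_trans (@sum_ge_term _ (fun v => ~~ low u v) (n u) x lux).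
have := yu; case/and4P=> cy _ /eqP hy /eqP py.
have [|||d [dp wd Td ld cd]] := IH y u _ cy.
- move: um; rewrite ltnS; apply: leq_trans; apply: proper_card; apply/properP.
  have wy := w_gt0 y; split.
    by apply/subsetP => v; rewrite !inE py => /lt_trans -> //; rewrite ltrDl.
  by exists y; rewrite !inE ?ltxx // py ltrDl.
- by rewrite usedC.
- exact: climbs_asym.
exists (y :: d); split=> //=; rewrite ?cy ?Td ?ld //.
- by apply/andP; split.
- by rewrite wt_cons wd py addrC.
Qed.

Lemma glue v d1 d2 : path used v d1 -> path used v d2 ->
  T (last v d1) -> T (last v d2) -> last v d1 != last v d2 -> wt d1 + w v + wt d2 = lam ->
  tight (rev d1 ++ v :: d2) /\ sorted used (rev d1 ++ v :: d2).
Proof.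
move=> p1 p2 T1 T2 d12 wE.
have sub : subrel used adj by move=> a b /used_edge/and4P[].
have s1 (e : rel V) : symmetric e -> path e v d1 -> sorted e (rcons (rev d1) v).
  move=> eC; rewrite -rev_cons rev_sorted /=.
  by rewrite (eq_path (e' := e)) // => a b; rewrite eC.
split; last first.
  by rewrite -cat_rcons -rev_cons; move: (s1 _ usedC p1); rewrite -rev_cons rev_cons;
    case: (rev d1) => [|a r] //=; rewrite ?cat_path ?rcons_path ?last_rcons => ->.
rewrite /tight connectingE head_rev T1 T2 d12 (s1 _ adjC (sub_path sub p1)) (sub_path sub p2) /=.
by rewrite wt_cat wt_cons wt_rev addrA wE.
Qed.

(** If some home carries exactly half, one of the two edges must come from it; another home with
    half, other than [h b], would leave nothing for [h b]. Strictness at the remaining homes is what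
    allows the pair to be removed. *)
Lemma labels_exist v : ~~ T v -> cen v -> (0 < \sum_u n v u)%N -> exists a b,
  [/\ used v a, used v b, h a != h b &
    forall s, s != h a -> s != h b -> (2 * \sum_(u | h u == s) n v u < \sum_u n v u)%N].
Proof.
move=> vT cv deg0; have [_ _ _ dom _] := adm; have {}dom := dom v vT cv.
have split_deg s : (\sum_u n v u = \sum_(u | h u == s) n v u + \sum_(u | h u != s) n v u)%N.
  by rewrite (bigID (fun u => h u == s)).
have other s : exists2 b, h b != s & used v b.
  by apply: psum_exists; have := dom s; have := split_deg s; lia.
have disjoint_le s t : s != t -> (\sum_(u | h u == s) n v u <= \sum_(u | h u != t) n v u)%N.
  move=> st; rewrite [leqLHS]big_mkcond [leqRHS]big_mkcond; apply: leq_sum => u _.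
  by case: eqP => // ->; rewrite st.
case: (pickP (fun s => 2 * \sum_(u | h u == s) n v u == \sum_u n v u)%N) => [s0 /eqP Es|none].
  have [b hb vb] := other s0.
  have [a /eqP ha va] : exists2 a, h a == s0 & used v a.
    by apply: psum_exists; have := split_deg s0; lia.
  exists a, b; split=> //; first by rewrite ha eq_sym.
  move=> s; rewrite ha => s0' sb; rewrite ltn_neqAle dom andbT; apply/eqP => Es'.
  have : (\sum_(u | h u == s) n v u + \sum_(u | h u == h b) n v u <= \sum_(u | h u != s0) n v u)%N.
    rewrite [X in (X + _)%N]big_mkcond [X in (_ + X)%N]big_mkcond -big_split [leqRHS]big_mkcond.
    apply: leq_sum => u _ /=; case: eqP => [->|_]; first by rewrite (negbTE sb) s0' addn0.
    by case: eqP => // ->; rewrite hb.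
  have : (n v b <= \sum_(u | h u == h b) n v u)%N by apply: sum_ge_term.
  by have := split_deg s0; move: vb; rewrite /used /=; lia.
have [a _ va] := psum_exists deg0; have [b hb vb] := other (h a).
exists a, b; split=> //; first by rewrite eq_sym.
by move=> s _ _; rewrite ltn_neqAle dom none.
Qed.

Lemma used_path_exists u0 v0 : used u0 v0 -> exists q, [/\ tight q, sorted used q &
  forall v, v \in q -> cen v -> exists q1 a b q2, q = rcons q1 a ++ v :: b :: q2 /\
    forall s, s != h a -> s != h b -> (2 * \sum_(u | h u == s) n v u < \sum_u n v u)%N].
Proof.
move=> uv0.
pose cand u := ~~ cen u && [exists x, used u x && ~~ low u x].
have [u1 cand1] : exists u, cand u.
  have /orP[/andP[c l]|/andP[c l]] := high_end (used_edge uv0).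
    by exists u0; rewrite /cand c; apply/existsP; exists v0; rewrite uv0.
  by exists v0; rewrite /cand c; apply/existsP; exists u0; rewrite usedC uv0.
(* At the greatest [p] an edge that is not low cannot climb, since balance at its other end would
   give a candidate further out. It is a summit or a crossing edge, and descents on both sides
   complete a tight walk. *)
have [u /andP[cu /existsP[x /andP[ux lux]]] umax] := @arg_maxP _ _ _ u1 cand p cand1.
have := used_edge ux; case/and4P=> _ bu bx /or4P[H|H|H|/orP[H|H]].
- case/and4P: (H) => _ cx _ /eqP px; have wu := w_gt0 u; have pu := p_ge0 u.
  have xT : ~~ T x.
    apply/negP => xT; move: bx; rewrite /based xT => /and3P[/eqP p0 _ _].
    by rewrite p0 in px; node_lra.
  have [y ly xy] : exists2 y, ~~ low x y & used x y.
    apply: psum_exists; case: adm => _ _ <- // _ _.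
    by rewrite usedC in ux; exact: leq_trans (@sum_ge_term _ (low x) (n x) u H).
  have : cand x by rewrite /cand cx; apply/existsP; exists y; rewrite ly xy.
  by move/umax; rewrite /= px gerDl leNgt wu.
- by rewrite /low H in lux.
- case/and4P: (H) => _ cx /eqP px /eqP pxl.
  have xT : ~~ T x by apply/negP => xT; move: bx; rewrite /based xT cx => /and3P[].
  have summit a : used x a -> exists d, [/\ path used x (a :: d), wt (a :: d) = p x,
      T (last a d), last a d = h a & all (predC cen) (a :: d)].
    move=> xa; have : summits a x.
      have := used_edge xa; case/and4P=> _ _ _ /or4P[H'|H'|H'|/orP[//|H']];
      by case/and4P: H'; rewrite ?cx.
    case/and4P=> ca _ /eqP pa _; have ax := xa; rewrite usedC in ax.
    have [|d [d1 d2 d3 d4 d5]] := descent ca ax; first by rewrite /low /climbs cx.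
    by exists d; rewrite wt_cons d2 pa addrC; split=> //=; apply/andP.
  have [|a [b [xa xb hab lab]]] := labels_exist xT cx.
    by have xu := ux; rewrite usedC in xu; exact: leq_trans (@sum_ge_term _ predT (n x) u isT).
  have [d1 [p1 w1 T1 l1 c1]] := summit a xa; have [d2 [p2 w2 T2 l2 c2]] := summit b xb.
  have [tq sq] : tight (rev (a :: d1) ++ x :: b :: d2) /\ sorted used (rev (a :: d1) ++ x :: b :: d2).
    apply: glue => //; first by rewrite /= l1 l2.
    by rewrite w1 w2; node_lra.
  exists (rev (a :: d1) ++ x :: b :: d2); split=> // v.
  rewrite mem_cat mem_rev !inE => /orP[/(allP c1)|/orP[/eqP ->|/(allP c2)]] /=;
    try by move/negbTE => ->.
  by move=> _; exists (rev d1), a, b, d2; rewrite rev_cons.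
- by case/and4P: H => _; rewrite (negbTE cu).
- case/and4P: (H) => _ cx hux /eqP pE; have xu := ux; rewrite usedC in xu.
  have [d1 [p1 w1 T1 l1 c1]] := descent cu ux lux.
  have [|d2 [p2 w2 T2 l2 c2]] := descent cx xu; first by rewrite /low /climbs (negbTE hux) !andbF.
  have [tq sq] : tight (rev (u :: d1) ++ x :: d2) /\ sorted used (rev (u :: d1) ++ x :: d2).
    apply: glue => //; first by rewrite /= xu.
      by rewrite /= l1 l2.
    by rewrite wt_cons w1 w2; node_lra.
  exists (rev (u :: d1) ++ x :: d2); split=> // v; rewrite mem_cat mem_rev !inE.
  case/orP=> [/orP[/eqP->|/(allP c1)]|/orP[/eqP ->|/(allP c2)]] /=;
    by rewrite ?(negbTE cu) ?(negbTE cx) //; move/negbTE => ->.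
Qed.

End Decomposition.

Theorem decomposition n : admissible n ->
  exists L : seq (seq V), all tight L /\ forall u v, n u v = (\sum_(q <- L) hops q u v)%N.
Proof.
have [m] := ubnP (\sum_u \sum_v n u v)%N.
elim: m n => // m IH n nm adm; have [nC nE nbal ndom nev] := adm.
have [[u0 v0] /= uv0|none] := pickP (fun x : V * V => 0 < n x.1 x.2)%N; last first.
  exists [::]; split=> // u v; rewrite big_nil; apply/eqP.
  by have := none (u, v); rewrite /= lt0n => /negbFE.
have [q [tq sq qcen]] := used_path_exists adm (uv0 : used n u0 v0).
have mid (e : rel V) a b q1 q2 : sorted e (q1 ++ a :: b :: q2) -> e a b.
  elim: q1 => [|x q1 IHq] /=; first by case/andP.
  by move/path_sorted/IHq.
have le_n u v : (hops q u v <= n u v)%N.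
  have [-> //|hq] := posnP (hops q u v); apply: leq_trans (hops_le1 u v tq) _.
  have [q1 [q2 [] qE]] := hops_gt0 hq; move: sq; rewrite qE => /mid //.
  by rewrite /used /= nC.
pose n' u v := (n u v - hops q u v)%N.
have sumE v (P : pred V) : (\sum_(u | P u) n' v u + \sum_(u | P u) hops q v u = \sum_(u | P u) n v u)%N.
  by rewrite -big_split; apply: eq_bigr => u _; rewrite /= /n' subnK.
have deg v := hops_degree v tq.
have [||L [tL LE]] := IH n'.
- move: nm; rewrite ltnS; apply: leq_trans.
  have lt_sum (F G : V -> nat) x : (forall y, F y <= G y)%N -> (F x < G x)%N ->
      (\sum_y F y < \sum_y G y)%N.
    move=> FG Fx; rewrite (bigD1 x) // [ltnRHS](bigD1 x) //= -addSn leq_add //.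
    by apply: leq_sum => y _.
  have : exists u v, (0 < hops q u v)%N.
    case/andP: tq; case: (q) => // a [|b q'] /=; first by rewrite eqxx !andbF.
    by exists a, b; rewrite !eqxx.
  case=> u [v huv]; apply: (lt_sum _ _ u) => [y|].
    by apply: leq_sum => z _; exact: leq_subr.
  apply: (lt_sum _ _ v) => [y|]; first exact: leq_subr.
  by rewrite /n' -subn_gt0 subKn.
- split=> [u v|u v|v vT cv|v vT cv s|v vT cv].
  + by rewrite /n' nC hopsC.
  + by move=> uv; apply: nE; apply: leq_trans uv (leq_subr _ _).
  + have := nbal v vT cv; have := hops_balanced tq vT cv.
    by rewrite -!(sumE v); lia.
  + have [vq|vq] := boolP (v \in q); last first.
      have h0 (P : pred V) : (\sum_(u | P u) hops q v u = 0)%N.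
        by rewrite big1 // => u _; rewrite hops_notin.
      by have := ndom v vT cv s; rewrite -!(sumE v) !h0 !addn0.
    (* Removing [q] lowers the total by two and the shares of [h a] and [h b] by one each. Any other
       home is strictly below half, so, the total being even, twice its share is at most the total
       minus two. *)
    have [q1 [a [b [q2 [qE lab]]]]] := qcen v vq cv.
    have hE (P : pred V) : (\sum_(u | P u) hops q v u = P a + P b)%N.
      have uq := tight_uniq tq; rewrite qE in uq *.
      by rewrite (eq_bigr _ (fun u _ => hops_inner u uq)) big_split /= !sum_eq_op.
    have hab : h a != h b by rewrite qE in tq; exact: home_neq tq cv.
    have := sumE v (fun u => h u == s); have := sumE v predT; rewrite !hE /=.
    have := nev v vT cv; have := ndom v vT cv s.
    have := lab s; rewrite ![s == _]eq_sym.
    move: hab; have [->|] := eqVneq (h a) s => /=.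
      by rewrite eq_sym => /negbTE -> /=; lia.
    have [->|] := eqVneq (h b) s => /=; lia.
  + have := nev v vT cv; rewrite -!(sumE v) deg (negbTE vT) oddD.
    by rewrite muln2 odd_double addbF.
exists (q :: L); split=> [|u v]; first by rewrite /= tq.
by rewrite big_cons -LE /n' addnC subnK.
Qed.
End TerminalWalks.

(** * Half-integral multiflows *)

Section Lifting.
Variables (G : graph) (T : {set node G}).
Implicit Types (q : seq (node G)).

Definition adjacent (u v : node G) := [exists e : edge G, ends e == [set u; v]].

Lemma adjacentC : symmetric adjacent.
Proof. by move=> u v; apply: eq_existsb => e; rewrite setUC. Qed.

Lemma walk_path (x : node G) (s : seq (edge G * node G)) :
  is_walk x s -> path adjacent x (unzip2 s).
Proof.
elim: s x => //= -[e y] s IH x /andP[exy /IH ->]; rewrite andbT.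
by apply/existsP; exists e.
Qed.

(** The edges are distinct because each contains its first node, which no later edge contains. *)
Lemma path_walk (x : node G) q : uniq (x :: q) -> path adjacent x q ->
  exists s : seq (edge G * node G), [/\ unzip2 s = q, is_walk x s, uniq (unzip1 s) &
    forall e, e \in unzip1 s -> ends e \subset x :: q].
Proof.
elim: q x => [|y q IH] x; first by exists [::].
rewrite cons_uniq => /andP[xq uq] /= /andP[/existsP[e /eqP exy] pq].
have [s [sq ws us sub]] := IH y uq pq.
exists ((e, y) :: s); split=> /=; first by rewrite sq.
- by rewrite exy eqxx.
- rewrite us andbT; apply: contra xq => /sub/subsetP; apply.
  by rewrite exy !inE eqxx.
move=> e'; rewrite inE => /orP[/eqP ->|/sub/subsetP es].
  by apply/subsetP => v; rewrite exy !inE => /orP[]/eqP ->; rewrite eqxx ?orbT.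
by apply/subsetP => v /es; rewrite [in X in _ -> X]inE => ->; rewrite orbT.
Qed.

Lemma path_Tpath q : uniq q -> connecting adjacent [in T] q ->
  (forall q1 v q2, q1 != [::] -> q2 != [::] -> q = q1 ++ v :: q2 -> v \notin T) ->
  exists P : Tpath T, VP P =i q.
Proof.
case: q => // x q uq /and4P[pq xT lT xl] inner.
have [s [sq ws us _]] := path_walk uq pq.
have ps : is_path x s by rewrite /is_path ws us.
have szs : (size s <= #|edge G|)%N := is_path_size ps.
have tP : is_Tpath T x s.
  rewrite /is_Tpath ps sq xT lT xl /=; apply/allP => v.
  case/lastP: q {pq lT xl sq} uq inner => // q y uq inner; rewrite belast_rcons /= => vq.
  case/splitPr: vq uq inner => q1 q2 _ inner.
  by apply: (inner (x :: q1) v (rcons q2 y)) => //; [case: (q2) | rewrite rcons_cat].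
exists (exist _ (x, Bseq szs) tP) => v.
by rewrite /VP inE /= sq.
Qed.

(** A T-path is only edge-simple and may repeat nodes; shortening makes it simple but may lose
    nodes, hence an inclusion. *)
Lemma Tpath_path (P : Tpath T) :
  exists q, [/\ connecting adjacent [in T] q, uniq q & {subset q <= VP P}].
Proof.
case: P => -[x s] tP; have := tP; rewrite /is_Tpath /=.
case/and5P=> /andP[/walk_path ps _] xT lT xl _.
case: (shortenP ps) lT xl => q pq uq sub lT xl.
exists (x :: q); split=> //=; first by rewrite pq xT lT.
by move=> v; rewrite !inE /= => /orP[->//|/sub ->]; rewrite orbT.
Qed.

(** Cutting out a closed part or splitting at a terminal in the interior reduces weight and length,
    and a walk that admits neither lifts to a T-path. *)
Lemma connecting_bound (w : node G -> rat) (lam : rat) :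
  (forall v, 0 < w v) -> (forall P : Tpath T, lam <= \sum_(v in VP P) w v) ->
  forall q, connecting adjacent [in T] q -> lam <= wt w q.
Proof.
move=> w0 bound q; have [m] := ubnP (size q); elim: m q => // m IH q qm cq.
have [uq|/not_uniq_split[q1 [v [q2 [q3 qE]]]]] := boolP (uniq q); last first.
  rewrite qE in qm cq *; apply: le_trans (ltW (wt_cut w0 _ _ _ _)).
  apply: IH (connecting_cut cq); move: qm; rewrite !size_cat /= size_cat /=; lia.
have [[q1 [v [q2 [q10 q20 qE vT]]]]|none] :=
    classic (exists q1 v q2, [/\ q1 != [::], q2 != [::], q = q1 ++ v :: q2 & v \in T]).
  rewrite qE in qm cq *; have [q' [cq' wq' sq']] := connecting_inner w0 q10 q20 vT cq.
  by apply: le_trans (ltW wq'); apply: IH cq'; apply: leq_trans sq' _.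
have [|P PE] := path_Tpath uq cq.
  by move=> q1 v q2 q10 q20 qE; apply/negP => vT; apply: none; exists q1, v, q2.
by rewrite /wt big_uniq //= (eq_bigl _ _ (fun v => esym (PE v))).
Qed.

End Lifting.

Lemma sum_weight_count (I J : finType) (A : I -> {set J}) (L : seq I) (v : J) :
  (\sum_(i | v \in A i) count_mem i L = \sum_(i <- L) (v \in A i))%N.
Proof.
elim: L => [|j L IH]; first by rewrite big_nil big1.
rewrite big_cons -IH /= big_split /=; congr (_ + _)%N.
have [vj|vj] := boolP (v \in A j).
  by rewrite (bigD1 j) //= eqxx big1 // => i /andP[_ /negbTE]; rewrite eq_sym => ->.
by rewrite big1 // => i vi; case: eqP => // ji; rewrite ji vi in vj.
Qed.

Theorem positive_cost_half_integral (G : graph) (T : {set node G}) (c : node G -> nat)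
    (a : node G -> rat) (lam : rat) :
  (forall v, 0 < a v) ->
  exists F : Tpath T -> rat, [/\ feasible c F, half_integer F &
    forall F' : Tpath T -> rat, feasible c F' ->
      \sum_P (lam - \sum_(v in VP P) a v) * F' P <= \sum_P (lam - \sum_(v in VP P) a v) * F P].
Proof.
move=> a0; pose r (P : Tpath T) := lam - \sum_(v in VP P) a v.
have VP0 (P : Tpath T) : VP P != set0.
  by apply/set0Pn; exists (val P).1; rewrite inE mem_head.
have [F0 [l [F0_ge0 F0_le l0 rl opt]]] :=
  @packing_duality _ _ (@VP G T) (fun v => (c v)%:R) r (fun v => ler0n _ _) VP0.
pose w v := a v + l v.
have w0 v : 0 < w v by rewrite ltr_wpDr.
have wE (P : Tpath T) : \sum_(v in VP P) w v = \sum_(v in VP P) l v - r P + lam.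
  by rewrite /r big_split /=; lra.
have w_ge (P : Tpath T) : lam <= \sum_(v in VP P) w v.
  by rewrite wE lerDr subr_ge0.
(* Complementary slackness: the nonnegative sums [s1] and [s2] add up to the duality gap, which is
   not positive. *)
have [slackP slackV] : (forall P, F0 P != 0 -> \sum_(v in VP P) w v = lam) /\
    (forall v, l v != 0 -> load F0 v = (c v)%:R).
  pose s1 := \sum_(P : Tpath T) (\sum_(v in VP P) l v - r P) * F0 P.
  pose s2 := \sum_v l v * ((c v)%:R - load F0 v).
  have n1 P : 0 <= (\sum_(v in VP P) l v - r P) * F0 P by rewrite mulr_ge0 ?subr_ge0.
  have n2 v : 0 <= l v * ((c v)%:R - load F0 v) by rewrite mulr_ge0 ?subr_ge0 ?F0_le.
  have s12 : s1 + s2 <= 0.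
    rewrite /s1 /s2; under eq_bigr => P _ do rewrite mulrBl.
    under [X in _ + X]eq_bigr => v _ do rewrite mulrBr [l v * (c v)%:R]mulrC.
    by rewrite !sumrB sum_incidence /load; lra.
  have s1p : 0 <= s1 by exact: sumr_ge0.
  have s2p : 0 <= s2 by exact: sumr_ge0.
  have s10 : s1 = 0 by lra.
  have s20 : s2 = 0 by lra.
  split=> [P FP|v lv].
    have /allP/(_ P (mem_index_enum _)) : all (fun P => true ==> ((\sum_(v in VP P) l v - r P) * F0 P == 0)) (index_enum (Tpath T)).
      by rewrite -psumr_eq0 // -/s1 s10.
    by rewrite /= mulf_eq0 (negbTE FP) orbF wE => /eqP ->; rewrite add0r.
  have /allP/(_ v (mem_index_enum _)) : all (fun v => true ==> (l v * ((c v)%:R - load F0 v) == 0)) (index_enum (node G)).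
    by rewrite -psumr_eq0 // -/s2 s20.
  by rewrite /= mulf_eq0 (negbTE lv) /= subr_eq0 => /eqP ->.
have bound := connecting_bound w0 w_ge.
have /fin_all_exists[arm armE] := arms_exist (@adjacentC G) w0 bound.
pose p v := (arm v).1.1; pose h v := (arm v).1.2; pose cen v := (arm v).2.
have p0 v : 0 <= p v by have := armE v; rewrite /p; case: (arm v) => -[? ?] ? [].
have arms v q1 q2 : tight (@adjacent G) [in T] w lam (q1 ++ v :: q2) ->
    if cen v then wt w q1 = p v /\ wt w q2 = p v
    else 2%:R * p v + w v < lam /\
      ((head v q1 = h v /\ wt w q1 = p v) \/ (last v q2 = h v /\ wt w q2 = p v)).
  by have := armE v; rewrite /p /h /cen; case: (arm v) => -[? ?] ? [_]; apply.
(* A path in the support has the least possible weight [lam], so making it simple loses no node: a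
   lost node would have positive weight. *)
have /fin_all_exists[tau tauE] (P : Tpath T) : exists q, F0 P != 0 ->
    tight (@adjacent G) [in T] w lam q /\ q =i VP P.
  have [q [cq uq sub]] := Tpath_path P; exists q => /slackP wP.
  have wq : wt w q = \sum_(v in q) w v by rewrite /wt big_uniq.
  have split_w : lam = wt w q + \sum_(v in VP P | v \notin q) w v.
    rewrite -wP (bigID (mem q)) wq /=; congr (_ + _); apply: eq_bigl => v.
    by rewrite andb_idl // => /sub.
  have rest0 : 0 <= \sum_(v in VP P | v \notin q) w v by apply: sumr_ge0 => v _; exact: ltW.
  have lq := bound q cq; have wlam : wt w q = lam by lra.
  split=> [|v]; first by rewrite /tight cq wlam eqxx.
  apply/idP/idP => [/sub //|vP]; apply: contraT => vq.
  have : 0 < \sum_(v in VP P | v \notin q) w v.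
    rewrite (bigD1 v) ?vP //= ltr_wpDr // sumr_ge0 // => u _; exact: ltW.
  lra.
pose f u v := \sum_P F0 P * (hops (tau P) u v)%:R.
have fsum v (P : pred (node G)) :
    \sum_(u | P u) f v u = \sum_Q F0 Q * (\sum_(u | P u) hops (tau Q) v u)%:R.
  rewrite exchange_big /=; apply: eq_bigr => Q _.
  by rewrite -mulr_sumr natr_sum.
have on_tight (Q : Tpath T) (x y : nat) :
    (tight (@adjacent G) [in T] w lam (tau Q) -> x = y) -> F0 Q * x%:R = F0 Q * y%:R.
  by move=> xy; have [->|/tauE[/xy -> //]] := eqVneq (F0 Q) 0; rewrite !mul0r.
have fdeg v : \sum_u f v u = load F0 v * (if v \in T then 1 else 2)%:R.
  rewrite fsum /load [X in _ = X * _]big_mkcond /= mulr_suml; apply: eq_bigr => Q _.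
  have [->|/tauE[tQ QE]] := eqVneq (F0 Q) 0; first by rewrite mul0r if_same mul0r.
  rewrite (hops_degree w0 bound v tQ) QE natrM mulrA.
  by case: (v \in VP Q); rewrite ?mulr1 ?mulr0 ?mul0r.
pose cap v := if v \in T then c v else (2 * c v)%N.
have capE v : (cap v)%:R = (c v)%:R * (if v \in T then 1 else 2)%:R :> rat.
  by rewrite /cap; case: ifP => _; rewrite ?mulr1 // natrM mulrC.
have [||v vT cv|v vT cv s|v|n [nC n0 nbal ndom ncap]] :=
    @dominated_rounding _ [in T] cen h (low w p h cen) c f.
- by move=> u v; apply: eq_bigr => Q _; rewrite hopsC.
- by move=> u v; apply: sumr_ge0 => Q _; rewrite mulr_ge0.
- rewrite !fsum; apply: eq_bigr => Q _; apply: on_tight => tQ.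
  exact: (hops_balanced (@adjacentC G) w0 bound arms tQ vT cv).
- rewrite !fsum mulr_sumr; apply: ler_sum => Q _; rewrite mulrCA.
  have [->|/tauE[tQ _]] := eqVneq (F0 Q) 0; first by rewrite !mul0r.
  rewrite ler_wpM2l // -natrM ler_nat.
  exact: (hops_dominated w0 bound arms _ tQ vT cv).
- by rewrite fdeg -/(cap v) capE ler_wpM2r ?F0_le.
have adm : admissible (@adjacent G) [in T] w lam p h cen n.
  split=> // [u v nuv|v vT cv]; last by have [_ + _] := ncap v; apply.
  have fuv : f u v != 0 by apply: contraTneq nuv => /n0 ->.
  have [Q /andP[FQ hQ]] : exists Q, (F0 Q != 0) && (0 < hops (tau Q) u v)%N.
    apply/existsP; apply: contraR fuv => /existsPn none; apply/eqP/big1 => Q _.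
    have := none Q; rewrite negb_and negbK -eqn0Ngt.
    by case/orP=> /eqP ->; rewrite ?mul0r ?mulr0.
  exact: (hops_edge (@adjacentC G) w0 bound arms (tauE Q FQ).1 hQ).
have [L [/allP tL LE]] := decomposition (@adjacentC G) w0 bound p0 arms adm.
have [L' [tL' L'E]] : exists L' : seq (Tpath T),
    (forall P, P \in L' -> \sum_(v in VP P) w v = lam) /\
    forall v, (\sum_(P <- L') (v \in VP P) = \sum_(q <- L) (v \in q))%N.
  elim: (L) tL => [|q L1 IH] tL1; first by exists [::]; split=> // v; rewrite !big_nil.
  have [|L' [tL' L'E]] := IH; first by move=> q' q'L; apply: tL1; rewrite inE q'L orbT.
  have tq := tL1 q (mem_head _ _); have uq := tight_uniq w0 bound tq.
  have [cq /eqP wq] := andP tq.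
  have [|P PE] := path_Tpath uq cq.
    move=> q1 v q2 q10 q20 qE; rewrite qE in tq.
    exact: (tight_inner w0 bound q10 q20 tq).
  exists (P :: L'); split=> [P'|v]; last by rewrite !big_cons L'E PE.
  rewrite inE => /orP[/eqP -> |/tL' //].
  by rewrite -wq /wt big_uniq //=; apply: eq_bigl => v; rewrite PE.
pose N v := (\sum_(q <- L) (v \in q))%N.
have Ndeg v : (\sum_u n v u = N v * if v \in T then 1 else 2)%N.
  rewrite (eq_bigr _ (fun u _ => LE v u)) exchange_big /= big_distrl /=.
  by rewrite !big_seq; apply: eq_bigr => q qL; rewrite (hops_degree w0 bound v (tL q qL)).
pose F (P : Tpath T) := (count_mem P L')%:R / 2%:R : rat.
have loadF v : load F v = (N v)%:R / 2%:R.
  by rewrite /load -mulr_suml -natr_sum sum_weight_count L'E.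
have N_le v : (N v <= 2 * c v)%N.
  have [+ _ _] := ncap v; rewrite Ndeg /=; case: ifP => _; first by rewrite muln1.
  by rewrite mulnC leq_mul2l.
have N_eq v : l v != 0 -> N v = (2 * c v)%N.
  move=> /slackV cv; have [_ _ +] := ncap v; rewrite Ndeg fdeg cv -/(cap v) capE => /(_ erefl).
  rewrite /cap; case: ifP => _ /=; first by rewrite muln1.
  by rewrite mulnC => /eqP; rewrite eqn_mul2l => /eqP.
exists F; split=> [|P|F' [F'0 F'le]].
- split=> [P|v]; first by rewrite divr_ge0.
  by rewrite loadF ler_pdivrMr ?ltr0n // -natrM ler_nat mulnC.
- by exists (count_mem P L').
(* Dual feasibility bounds the objective of [F'] by its load weighted with [l]. For [F] this is an
   equality, its paths being tight, and [F] saturates every node with [l v != 0], so no feasible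
   load is larger there. *)
apply: (@le_trans _ _ (\sum_P (\sum_(v in VP P) l v) * F' P)).
  by apply: ler_sum => P _; apply: ler_wpM2r; [exact: F'0 | exact: rl].
have -> : \sum_P (lam - \sum_(v in VP P) a v) * F P = \sum_P (\sum_(v in VP P) l v) * F P.
  apply: eq_bigr => P _; rewrite /F -/(r P); have [/tL' wP|/count_memPn ->] := boolP (P \in L').
    by congr (_ * _); move: (wE P); rewrite wP; lra.
  by rewrite mul0r !mulr0.
rewrite !sum_incidence; apply: ler_sum => v _.
have [->|lv] := eqVneq (l v) 0; first by rewrite !mul0r.
apply: ler_wpM2l => //; apply: le_trans (F'le v) _.
by rewrite -/(load F v) loadF N_eq // natrM mulrC mulKf.
Qed.

(** * From positive costs to arbitrary costs *)

Section VanishingPerturbation.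
Variables (G : graph) (T : {set node G}) (c a : node G -> nat) (lambda : nat).
Implicit Types (F : Tpath T -> rat).

Lemma Phi_sum F :
  Phi a lambda F = \sum_P (lambda%:R - (\sum_(v in VP P) a v)%:R) * F P.
Proof.
rewrite /Phi /value /cost mulr_sumr -sumrB.
by apply: eq_bigr => P _; rewrite mulrBl.
Qed.

Lemma Phi_half_integer F : half_integer F -> 2%:R * Phi a lambda F \is a Num.int.
Proof.
move=> hF; rewrite Phi_sum mulr_sumr rpred_sum // => P _.
have [k ->] := hF P; rewrite mulrCA mulrC mulrCA divff ?pnatr_eq0 // mulr1.
by apply: rpredM; rewrite ?rpredB ?rpred_nat.
Qed.

(** Raising all costs by [eps] lowers the objective by [eps] times the total load, which feasibility
    bounds by the total capacity. *)
Lemma near_optimal (eps : rat) : 0 < eps -> exists F, [/\ feasible c F, half_integer F &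
  forall F', feasible c F' -> Phi a lambda F' <= Phi a lambda F + eps * (\sum_v c v)%:R].
Proof.
move=> eps0; have [|F [feasF hF opt]] :=
    @positive_cost_half_integral G T c (fun v => (a v)%:R + eps) lambda%:R.
  by move=> v; rewrite ltr_wpDl.
exists F; split=> // F' feasF'; have := opt F' feasF'.
have perturbed F1 : \sum_P (lambda%:R - \sum_(v in VP P) ((a v)%:R + eps)) * F1 P =
    Phi a lambda F1 - eps * \sum_v load F1 v.
  have := sum_incidence (@VP G T) F1 (fun=> 1).
  rewrite (eq_bigr (fun v => load F1 v)) => [<-|v _]; last by rewrite mul1r.
  rewrite Phi_sum mulr_sumr -sumrB; apply: eq_bigr => P _.
  rewrite big_split /= -natr_sum [in LHS](eq_bigr (fun=> eps * 1)) => [|v _]; last by rewrite mulr1.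
  rewrite -mulr_sumr; ring.
rewrite !perturbed => le; have [F0 _] := feasF; have [_ F'c] := feasF'.
have l0 : 0 <= eps * \sum_v load F v.
  by rewrite mulr_ge0 ?(ltW eps0) // sumr_ge0 // => v _; exact: sumr_ge0.
have : eps * \sum_v load F' v <= eps * (\sum_v c v)%:R.
  by rewrite ler_pM2l // natr_sum; apply: ler_sum => v _; exact: F'c.
lra.
Qed.

End VanishingPerturbation.

Theorem theorem2p1 (G : graph) (T : {set node G}) (c a : node G -> nat)
    (lambda : nat) :
  exists F : Tpath T -> rat, optimal c a lambda F /\ half_integer F.
Proof.
pose C : rat := (\sum_v c v)%:R.
have C0 : 0 <= C by rewrite ler0n.
have gap d : 0 < d -> d / (C + 1) * C < d.
  by move=> d0; rewrite mulrAC ltr_pdivrMr ?ltr_wpDl // ltr_pM2l // ltrDl.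
have step d : 0 < d -> 0 < d / (C + 1) by move=> d0; rewrite divr_gt0 // ltr_wpDl.
(* The denominator [C + 1] makes the loss strictly less than 1/2, and values of [Phi] on
   half-integer multiflows are multiples of 1/2. *)
have [|F [feasF hF near]] := @near_optimal G T c a lambda (2%:R^-1 / (C + 1)).
  by apply: step; rewrite invr_gt0.
exists F; split=> //; split=> // F' feasF'; rewrite leNgt; apply/negP => lt.
(* No optimum is presupposed: if [F'] beat [F], a perturbation scaled to the difference would give a
   half-integer [F1] better than [F], hence better by at least 1/2, which [near] forbids. *)
have [|F1 [feasF1 hF1 near1]] :=
    @near_optimal G T c a lambda ((Phi a lambda F' - Phi a lambda F) / (C + 1)).
  by apply: step; rewrite subr_gt0.
have := near1 _ feasF'; have := near _ feasF1; rewrite -/C.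
have := gap 2%:R^-1 (_ : _); rewrite invr_gt0 => /(_ isT) gap1.
have := gap (Phi a lambda F' - Phi a lambda F) (_ : _); rewrite subr_gt0 => /(_ lt) gap2.
have /intrP[x xE] := Phi_half_integer a lambda hF.
have /intrP[y yE] := Phi_half_integer a lambda hF1.
move=> le1 le2.
have xy : (x < y)%R by rewrite -(ltr_int rat) -xE -yE; lra.
have : (x + 1)%:~R <= y%:~R :> rat by rewrite ler_int lezD1.
rewrite intrD -xE -yE; lra.
Qed.
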